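(* Let $(\mathcal{X},\mathcal{B})$, $(\Theta,\mathcal{C})$, $P(\cdot\mid\theta)$, $\nu$, $M$, $Q(\cdot\mid x)$ and $R(\cdot\mid\eta)$ be as in the context. Let $f:\Theta\times\Theta\to[0,\infty)$ be a measurable function, and put $$\mathcal{T}(\eta)=\int_\Theta f(\theta,\eta)\,R(d\theta\mid\eta).$$ Assume: (i) for every $\varphi\in\Phi_f$ there exist measurable sets $K_1\subseteq K_2\subseteq\cdots$ with $\bigcup_i K_i=\Theta$ such that for all $i$, $0<\nu(K_i)<\infty$ and $\int_{K_i}\mathsf{R}(\hat\varphi;\theta)\,\nu(d\theta)<\infty$; (ii) $0<\mathcal{T}(\eta)<\infty$ for all $\eta\in\Theta$, and there exist measurable sets $K_1\subseteq K_2\subseteq\cdots$ with $\bigcup_i K_i=\Theta$ such that for all $i$, $0<\nu(K_i)<\infty$ and $\int_{K_i}\mathcal{T}(\eta)\,\nu(d\eta)<\infty$; (iii) there exists $\epsilon>0$ such that $\mathcal{T}(\eta)\ge\epsilon$ except possibly for $\eta$ in a set of $\nu$-measure $0$; (iv) $f(\theta,\eta)=f(\eta,\theta)$ for all $\theta,\eta\in\Theta$; (v) the Markov chain on $\Theta$ with transition kernel $$T(d\theta\mid\eta)=\frac{f(\theta,\eta)}{\mathcal{T}(\eta)}\,R(d\theta\mid\eta)$$ is locally $\nu$-recurrent. Then the family $\mathcal{F}_\nu$ of all bounded perturbations of $\nu$ is strongly admissible with respect to $\Phi_f$; that is, for every $\nu_u\in\mathcal{F}_\nu$ and every $\varphi\in\Phi_f$,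 the formal Bayes estimator $\hat\varphi_u$ of $\varphi$ under the prior $\nu_u$ is almost-$\nu_u$ admissible.
   Context: Setting. $\mathcal{X}$ (sample space) and $\Theta$ (parameter space) are Polish spaces with Borel $\sigma$-algebras $\mathcal{B}$ and $\mathcal{C}$. $\{P(\cdot\mid\theta):\theta\in\Theta\}$ is a family of probability measures on $(\mathcal{X},\mathcal{B})$ such that $P(B\mid\cdot)$ is $\mathcal{C}$-measurable for each $B\in\mathcal{B}$. The prior $\nu$ is a $\sigma$-finite measure on $(\Theta,\mathcal{C})$ with $\nu(\Theta)=\infty$, and the marginal $M(dx)=\int_\Theta P(dx\mid\theta)\,\nu(d\theta)$ is assumed $\sigma$-finite. The formal posterior $Q(d\theta\mid x)$ is a Markov kernel from $\mathcal{X}$ to $\Theta$ (a probability measure on $(\Theta,\mathcal C)$ for each $x$, measurable in $x$) satisfying the disintegration $Q(d\theta\mid x)\,M(dx)=P(dx\mid\theta)\,\nu(d\theta)$ as measures on $\mathcal{X}\times\Theta$. The expected posterior (Eaton kernel) is the Markov kernel on $\Theta$ $$R(d\theta\mid\eta)=\int_{\mathcal{X}}Q(d\theta\mid x)\,P(dx\mid\eta).$$ Bounded perturbations. $\mathcal{F}_\nu$ is the family of all measures $\nu_u(d\theta)=u(\theta)\,\nu(d\theta)$ where $u:\Theta\to(0,\infty)$ is measurable and there is a constant $c>1$ with $1/c<u(\theta)<c$ for all $\theta\in\Theta$. The formal posterior under $\nu_u$ is $Q_u(d\theta\mid x)=\frac{u(\theta)}{\hat u(x)}Q(d\theta\mid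 x)$ with $\hat u(x)=\int u(\theta)\,Q(d\theta\mid x)$. Estimation. For measurable $\varphi:\Theta\to\mathbb{R}^p$ ($p\ge1$), the formal Bayes estimator of $\varphi$ under squared error loss is the posterior mean: $\hat\varphi(x)=\int_\Theta\varphi(\theta)\,Q(d\theta\mid x)$ under $\nu$, and $\hat\varphi_u(x)=\int_\Theta\varphi(\theta)\,Q_u(d\theta\mid x)$ under $\nu_u$. The risk function of an estimator $\delta:\mathcal{X}\to\mathbb{R}^p$ of $\varphi(\theta)$ is $\mathsf{R}(\delta;\theta)=\int_{\mathcal{X}}\|\varphi(\theta)-\delta(x)\|^2\,P(dx\mid\theta)$, with $\|\cdot\|$ the Euclidean norm. For a $\sigma$-finite measure $\lambda$ on $\Theta$, the estimator $\delta$ is almost-$\lambda$ admissible if for every estimator $\delta_1$ with $\mathsf{R}(\delta_1;\theta)\le\mathsf{R}(\delta;\theta)$ for all $\theta\in\Theta$, the set $\{\theta:\mathsf{R}(\delta_1;\theta)<\mathsf{R}(\delta;\theta)\}$ has $\lambda$-measure $0$. The class $\Phi_f$ consists of all measurable $\varphi:\Theta\to\mathbb{R}^p$ ($p\ge 1$) for which there is a constant $0<M_\varphi<\infty$ with $\|\varphi(\theta)-\varphi(\eta)\|^2\le M_\varphi f(\theta,\eta)$ for all $\theta,\eta\in\Theta$. Local recurrence. Let $\xi$ be a non-trivial $\sigma$-finite measure on the state space of a time-homogeneous Markov chain $W=(W_0,W_1,\dots)$. A measurable set $D$ is $\xi$-proper if $0<\xi(D)<\infty$. A $\xi$-proper set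 $D$ is locally $\xi$-recurrent if $\Pr(W_n\in D\text{ for some }n\ge1\mid W_0=w)=1$ for all $w\in D$ outside a $\xi$-null set. The chain is locally $\xi$-recurrent if every $\xi$-proper set is locally $\xi$-recurrent. *)

(* Defs.v *)
From HB Require Import structures.
From mathcomp Require Import all_boot all_order all_algebra.
From mathcomp Require Import all_classical all_reals all_analysis.
From mathcomp Require Import measurable_realfun.

Set Implicit Arguments.
Unset Strict Implicit.
Unset Printing Implicit Defensive.
Import Order.TTheory GRing.Theory Num.Theory.
Import numFieldNormedType.Exports.

Local Open Scope classical_set_scope.
Local Open Scope ring_scope.
Local Open Scope ereal_scope.

Definition complete_metric (R : realType) (T : topologicalType)
    (dist : T -> T -> R) : Prop :=
  [/\ [/\ (forall x y, (0 <= dist x y)%R),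
          (forall x y, dist x y = 0%R <-> x = y),
          (forall x y, dist x y = dist y x) &
          (forall x y z, (dist x z <= dist x y + dist y z)%R)],
      (forall (x : T) (A : set T), nbhs x A <->
         exists2 e : R, (0 < e)%R & [set y | (dist x y < e)%R] `<=` A) &
      (forall s : nat -> T,
         (forall e : R, (0 < e)%R -> exists N, forall m n,
            (N <= m)%N -> (N <= n)%N -> (dist (s m) (s n) < e)%R) ->
         exists l : T, s @ \oo --> l)].

Definition polish (R : realType) (T : topologicalType) : Prop :=
  (exists dist : T -> T -> R, complete_metric dist) /\
  (exists2 S : set T, countable S & dense S).

Notation borel T := (g_sigma_algebraType (@open T)).

Section density.
Context d (T : measurableType d) (R : realType).
Variables (mu : {measure set T -> \bar R}) (g : T -> R).

Definition density (mg : measurable_fun [set: T] g)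
    (g0 : forall t, (0 <= g t)%R) : set T -> \bar R :=
  fun A => \int[mu]_(t in A) (g t)%:E.

Hypotheses (mg : measurable_fun [set: T] g) (g0 : forall t, (0 <= g t)%R).

Let density0 : density mg g0 set0 = 0.
Proof. by rewrite /density integral_set0. Qed.

Let density_ge0 A : 0 <= density mg g0 A.
Proof. by apply: integral_ge0 => t _; rewrite lee_fin. Qed.

Let density_sigma_additive : semi_sigma_additive (density mg g0).
Proof.
move=> F mF tF mUF; rewrite /density.
rewrite ge0_integral_bigcup//; last 2 first.
- exact/measurable_EFinP/measurable_funTS.
- by move=> t _; rewrite lee_fin.
apply: is_cvg_nneseries => n _ _.
by apply: integral_ge0 => t _; rewrite lee_fin.
Qed.

HB.instance Definition _ := isMeasure.Build _ _ R (density mg g0)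
  density0 density_ge0 density_sigma_additive.

End density.

Section marginal.
Context d d' (X : measurableType d) (Theta : measurableType d') (R : realType).
Variables (P : R.-ker Theta ~> X) (nu : {measure set Theta -> \bar R}).

Definition marginal (B : set X) : \bar R := \int[nu]_theta P theta B.

Let marginal0 : marginal set0 = 0.
Proof. by apply: integral0_eq => t _; rewrite measure0. Qed.

Let marginal_ge0 B : 0 <= marginal B.
Proof. exact: integral_ge0. Qed.

Let marginal_sigma_additive : semi_sigma_additive marginal.
Proof.
move=> F mF tF mUF; rewrite [X in _ --> X](_ : _ =
  \int[nu]_t (\sum_(n <oo) P t (F n))); last first.
  apply: eq_integral => t _.
  by apply/esym/cvg_lim => //; exact/measure_semi_sigma_additive.
apply/cvg_closeP; split.
  by apply: is_cvg_nneseries => n _ _; exact: integral_ge0.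
rewrite closeE// integral_nneseries// => n.
exact: measurable_kernel.
Qed.

HB.instance Definition _ := isMeasure.Build _ _ R marginal
  marginal0 marginal_ge0 marginal_sigma_additive.

End marginal.

Section posterior.
Context d d' (X : measurableType d) (Theta : measurableType d') (R : realType).

(* The disintegration Q(dtheta | x) M(dx) = P(dx | theta) nu(dtheta) *)
Definition formal_posterior (P : R.-pker Theta ~> X)
    (nu : {measure set Theta -> \bar R}) (Q : R.-pker X ~> Theta) : Prop :=
  forall C : set (X * Theta), measurable C ->
    \int[marginal P nu]_x Q x (xsection C x) =
    \int[nu]_theta P theta (ysection C theta).

Definition eaton_kernel (P : R.-pker Theta ~> X) (Q : R.-pker X ~> Theta) :
    Theta -> {measure set Theta -> \bar R} :=
  mkcomp_noparam P Q.

End posterior.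

Record bounded_weight d (Theta : measurableType d) (R : realType) := {
  weight :> Theta -> R ;
  measurable_weight : measurable_fun [set: Theta] weight ;
  weight_gt0 : forall theta, (0 < weight theta)%R ;
  weight_bounded : exists2 c : R, (1 < c)%R &
    forall theta, (c^-1 < weight theta < c)%R }.

Section perturbation.
Context d (Theta : measurableType d) (R : realType).
Variable u : bounded_weight Theta R.

Lemma weight_ge0 theta : (0 <= u theta)%R.
Proof. exact/ltW/weight_gt0. Qed.

Definition perturbed_prior (nu : {measure set Theta -> \bar R}) :
    {measure set Theta -> \bar R} :=
  density nu (measurable_weight u) weight_ge0.

(* In the next two definitions [q] is the posterior Q(. | x) at a given x. *)
Definition hat_weight (q : {measure set Theta -> \bar R}) : R :=
  (\int[q]_theta u theta)%R.

Lemma measurable_normalized_weight (q : {measure set Theta -> \bar R}) :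
  measurable_fun [set: Theta] (fun theta => u theta / hat_weight q)%R.
Proof. by apply: measurable_funM => //; exact: measurable_weight. Qed.

Lemma normalized_weight_ge0 (q : {measure set Theta -> \bar R}) theta :
  (0 <= u theta / hat_weight q)%R.
Proof.
apply: divr_ge0; first exact: weight_ge0.
by apply: Rintegral_ge0 => t _; exact: weight_ge0.
Qed.

Definition perturbed_posterior (q : {measure set Theta -> \bar R}) :
    {measure set Theta -> \bar R} :=
  density q (measurable_normalized_weight q) (normalized_weight_ge0 q).

End perturbation.

(* R^p is encoded as [p.-tuple R]; this is the squared Euclidean distance. *)
Definition sqdist (R : realType) (p : nat) (x y : p.-tuple R) : R :=
  (\sum_(i < p) (tnth x i - tnth y i) ^+ 2)%R.

Section estimation.
Context d d' (X : measurableType d) (Theta : measurableType d') (R : realType).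
Variable p : nat.

(* A coordinate whose integral is undefined or infinite gets a junk value. If
   [phi] is in [Phi f] and the integral of f(., eta) against the expected
   posterior at eta is finite for all eta, then [phi] is integrable under
   Q(. | x) for P(. | eta)-almost every x, so no risk depends on that value. *)
Definition mean (q : {measure set Theta -> \bar R})
    (phi : Theta -> p.-tuple R) : p.-tuple R :=
  [tuple (\int[q]_theta tnth (phi theta) i)%R | i < p].

Definition bayes_estimator (Q : X -> {measure set Theta -> \bar R})
    (phi : Theta -> p.-tuple R) : X -> p.-tuple R :=
  fun x => mean (Q x) phi.

Definition risk (P : R.-pker Theta ~> X) (phi : Theta -> p.-tuple R)
    (delta : X -> p.-tuple R) (theta : Theta) : \bar R :=
  \int[P theta]_x (sqdist (phi theta) (delta x))%:E.

Definition almost_admissible (P : R.-pker Theta ~> X)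
    (lambda : {measure set Theta -> \bar R}) (phi : Theta -> p.-tuple R)
    (delta : X -> p.-tuple R) : Prop :=
  forall delta1 : X -> p.-tuple R, measurable_fun [set: X] delta1 ->
    (forall theta, risk P phi delta1 theta <= risk P phi delta theta) ->
    lambda [set theta | risk P phi delta1 theta < risk P phi delta theta] = 0.

(* The part of the class Phi_f formed by the functions with values in R^p. *)
Definition Phi (f : Theta -> Theta -> R) (phi : Theta -> p.-tuple R) : Prop :=
  measurable_fun [set: Theta] phi /\
  exists2 M : R, (0 < M)%R &
    forall theta eta, (sqdist (phi theta) (phi eta) <= M * f theta eta)%R.

End estimation.

Definition exhaustion d (T : measurableType d) (R : realType)
    (nu : {measure set T -> \bar R}) (K : nat -> set T) : Prop :=
  [/\ forall i, measurable (K i),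
      forall i, K i `<=` K i.+1,
      \bigcup_i K i = [set: T] &
      forall i, 0 < nu (K i) < +oo].

Section markov_chain.
Context d d' (Omega : measurableType d) (S : measurableType d') (R : realType).

Definition history (W : nat -> Omega -> S) (n : nat) : set (set Omega) :=
  <<s \bigcup_(i in [set i | (i <= n)%N])
        preimage_set_system [set: Omega] (W i) measurable >>.

(* Under [Pr w], the process [W] is a time-homogeneous Markov chain started at
   [w] with transition function [T]: T (W n) A is a version of the conditional
   probability of [W n.+1 \in A] given the sigma-algebra [history W n]
   generated by W_0, ..., W_n. *)
Definition markov_chain (T : S -> set S -> \bar R)
    (Pr : S -> probability Omega R) (W : nat -> Omega -> S) : Prop :=
  [/\ forall n, measurable_fun [set: Omega] (W n),
      forall w A, measurable A -> Pr w (W 0%N @^-1` A) = \d_w A &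
      forall w n E A, history W n E -> measurable A ->
        Pr w (E `&` W n.+1 @^-1` A) = \int[Pr w]_(o in E) T (W n o) A].

Definition proper_set (xi : {measure set S -> \bar R}) (D : set S) : Prop :=
  measurable D /\ 0 < xi D < +oo.

Definition locally_recurrent_set (xi : {measure set S -> \bar R})
    (Pr : S -> probability Omega R) (W : nat -> Omega -> S)
    (D : set S) : Prop :=
  {ae xi, forall w, D w -> Pr w [set o | exists2 n, (1 <= n)%N & D (W n o)] = 1}.

Definition locally_recurrent (xi : {measure set S -> \bar R})
    (Pr : S -> probability Omega R) (W : nat -> Omega -> S) : Prop :=
  forall D, proper_set xi D -> locally_recurrent_set xi Pr W D.

End markov_chain.

Section transition.
Context d (Theta : measurableType d) (R : realType).
Variables (f : Theta -> Theta -> R) (K : Theta -> {measure set Theta -> \bar R}).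

Definition total_weight (eta : Theta) : \bar R :=
  \int[K eta]_theta (f theta eta)%:E.

(* [fine] loses nothing where [total_weight] is finite. *)
Definition weighted_kernel (eta : Theta) (A : set Theta) : \bar R :=
  \int[K eta]_(theta in A) (f theta eta / fine (total_weight eta))%:E.

End transition.

(* Main.v *)
Require Import Defs.
From HB Require Import structures.
From mathcomp Require Import all_boot all_order all_algebra.
From mathcomp Require Import all_classical all_reals all_analysis.
From mathcomp Require Import measurable_realfun.
From mathcomp Require Import ring lra.

Set Implicit Arguments.
Unset Strict Implicit.
Unset Printing Implicit Defensive.
Import Order.TTheory GRing.Theory Num.Theory.
Import numFieldNormedType.Exports.

Local Open Scope classical_set_scope.
Local Open Scope ring_scope.
Local Open Scope ereal_scope.

(** The proof is Blyth's method, with test functions supplied by the chain.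
    Write [delta] for the formal Bayes estimator of [phi] under the prior
    [lambda = u nu], let [delta1] be an estimator whose risk is nowhere larger,
    and fix a set [D] on which the integral of the normalizing function
    [total_weight] is finite.  If [v : Theta -> [0, 1]] is 1 on [D], then the
    integral over [D] of the risk difference against [lambda] is at most the
    integral of [v^2] times the risk difference, so it is enough to find such
    [v] for which the latter integral is arbitrarily small.

    The statistical half bounds that integral.  Conditionally on [x] the
    parameter has the law [pi = Q_u(. | x)], [delta x] is the [pi]-mean of
    [phi], and whatever the value [a = delta1 x] is,
      int (phi - delta)^2 v^2 dpi - int (phi - a)^2 v^2 dpi
        <= int int (phi(s) - phi(t))^2 (v(s) - v(t))^2 dpi(s) dpi(t)
    ([quadratic_loss_perturbation]).  Integrate this over [x] with respect to
    the marginal, replace [Q_u] by [Q] at the price of a power of the bound on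
    [u], and use that [phi] belongs to the class defined by [f]: by
    disintegration the right-hand side becomes a multiple of
      int int f(s, t) (v(s) - v(t))^2 R(ds | t) nu(dt),
    which is the Dirichlet form [energy] of [v] for the chain with kernel [T]
    ([blyth_inequality]).  This chain is reversible for the measure
    [total_weight nu], because [f] is symmetric and two parameters that are
    drawn independently from [Q(. | x)] are exchangeable.

    The Markov half produces [v].  Let [a_n(x)] be the probability that the
    chain started at [x] avoids [D] at the times 1, ..., n ([avoid]), and let
    [v_n] be the probability that it visits [D] at one of the times
    0, ..., n ([hit]).  Then [v_n] is 1 on [D] and [v_n <= v_(n+1) = T v_n] off
    [D], which with reversibility gives
      energy(v_n) <= 2 int_D a_(n+1) total_weight dnu
    ([energy_hit_le]).  Local recurrence says that [a_n] tends to 0 almost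
    everywhere on [D], so the energies tend to 0 by dominated convergence.

    Two integrability facts make this rigorous.  The risk of [delta] is at most
    a constant times [total_weight] ([risk_bayes_estimator_le]) and
    [int v_n total_weight dnu] is finite ([integral_hit_lt_pinfty]), so the
    weighted risks are finite and may be subtracted.  And for almost every [x]
    the function [phi] is square integrable for [Q(. | x)]
    ([posterior_integral_lt_pinfty_ae]), so [delta x] is a genuine mean. *)

(** * Functionals that behave like integrals *)

Section integral_functional.
Context d (T : measurableType d) (R : realType).
Implicit Types (L : (T -> \bar R) -> \bar R) (f g : T -> \bar R).

Definition nonneg_measurable f : Prop :=
  measurable_fun [set: T] f /\ forall x, 0 <= f x.

(** The formulas below for integrals against densities, composed kernels and
    disintegrated laws have the form [L1 f = L2 f] where both sides are of this
    kind; the closure lemmas and [functional_ext] reduce them to the case where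
    [f] is an indicator. *)
Record integral_functional L : Prop := {
  functional_ge0 : forall f, nonneg_measurable f -> 0 <= L f ;
  functional_le : forall f g, nonneg_measurable f -> nonneg_measurable g ->
    (forall x, f x <= g x) -> L f <= L g ;
  functionalD : forall f g, nonneg_measurable f -> nonneg_measurable g ->
    L (fun x => f x + g x) = L f + L g ;
  functionalZ : forall (k : R) f, (0 <= k)%R -> nonneg_measurable f ->
    L (fun x => k%:E * f x) = k%:E * L f ;
  functional_lim : forall F : (T -> \bar R)^nat,
    (forall n, nonneg_measurable (F n)) ->
    (forall x, nondecreasing_seq (F ^~ x)) ->
    L (fun x => limn (F ^~ x)) = limn (fun n => L (F n)) }.

Lemma functional0 L : integral_functional L -> L (cst 0) = 0.
Proof.
move=> hL; have h0 : nonneg_measurable (cst 0).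
  by split => [|x]; [exact: measurable_cst|exact: lexx].
rewrite -[RHS](mul0e (L (cst 0))) -(functionalZ hL _ h0)//.
by congr L; apply/funext => x; rewrite mul0e.
Qed.

Import HBNNSimple.

(** Such a functional is determined by its values on indicators, since a
    nonnegative measurable function is an increasing limit of simple ones. *)
Lemma functional_ext L1 L2 :
  integral_functional L1 -> integral_functional L2 ->
  (forall A, measurable A -> L1 (EFin \o \1_A) = L2 (EFin \o \1_A)) ->
  forall f, nonneg_measurable f -> L1 f = L2 f.
Proof.
move=> h1 h2 L12 f [mf f0].
pose g := nnsfun_approx measurableT mf.
have hind (A : set T) : measurable A ->
    nonneg_measurable (fun x => (\1_A x)%:E : \bar R).
  move=> mA; split; last by move=> x; rewrite lee_fin.
  exact/measurable_EFinP.
have hg n : nonneg_measurable (fun x => (g n x)%:E).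
  by split; [exact/measurable_EFinP|move=> x; rewrite lee_fin].
have -> : f = fun x => limn (fun n => (g n x)%:E).
  apply/funext => x; apply/esym/cvg_lim => //.
  exact: (@cvg_nnsfun_approx _ _ _ _ measurableT _ mf).
have ndg x : nondecreasing_seq (fun n => (g n x)%:E).
  by move=> m n mn; rewrite lee_fin; exact/lefP/nd_nnsfun_approx.
rewrite !functional_lim//; congr (limn _); apply/funext => n.
have -> : (fun x => (g n x)%:E) =
    (fun x => \sum_(y <- finmap.enum_fset (fset_set (range (g n))))
      (y * \1_(g n @^-1` [set y]) x)%:E).
  by apply/funext => x; rewrite fimfunE fsbig_finite//= sumEFin.
elim: (finmap.enum_fset _) => [|y s ih].
  have -> : (fun x : T => \sum_(y <- [::])
      (y * \1_(g n @^-1` [set y]) x)%:E) = cst 0.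
    by apply/funext => x; rewrite big_nil.
  by rewrite !functional0.
have hy z : nonneg_measurable (fun x => (z * \1_(g n @^-1` [set z]) x)%:E).
  split; last by move=> x; rewrite EFinM nnfun_muleindic_ge0.
  by apply/measurable_EFinP; apply: measurable_funM => //; exact: measurable_indic.
have hs : nonneg_measurable (fun x => \sum_(z <- s)
    (z * \1_(g n @^-1` [set z]) x)%:E).
  split; last by move=> x; apply: sume_ge0 => z _; apply: (hy z).2.
  by apply: emeasurable_sum => z; apply: (hy z).1.
have -> : (fun x => \sum_(z <- y :: s) (z * \1_(g n @^-1` [set z]) x)%:E) =
    (fun x => (y * \1_(g n @^-1` [set y]) x)%:E +
      \sum_(z <- s) (z * \1_(g n @^-1` [set z]) x)%:E).
  by apply/funext => x; rewrite big_cons.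
rewrite !functionalD// ih; congr (_ + _).
(* A negative [y] is not a value of the simple function, so that its level
   set is empty. *)
have [y0|y0] := leP 0%R y.
  under eq_fun do rewrite EFinM.
  by rewrite !functionalZ ?L12//; exact: hind.
rewrite preimage_nnfun0//.
have -> : (fun x : T => (y * \1_set0 x)%:E) = cst 0.
  by apply/funext => x; rewrite indic0 mulr0.
by rewrite !functional0.
Qed.

Lemma functional_integral (mu : {measure set T -> \bar R}) D : measurable D ->
  integral_functional (fun f => \int[mu]_(x in D) f x).
Proof.
move=> mD; split.
- by move=> f [mf f0]; exact: integral_ge0.
- move=> f g [mf f0] [mg g0] fg.
  by apply: ge0_le_integral => //; exact: measurable_funTS.
- move=> f g [mf f0] [mg g0].
  by rewrite ge0_integralD//; exact: measurable_funTS.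
- move=> k f k0 [mf f0].
  by rewrite ge0_integralZl//; exact: measurable_funTS.
- move=> F mF ndF; rewrite monotone_convergence// => n.
  + by apply: measurable_funTS; exact: (mF n).1.
  + by move=> x _; exact: (mF n).2.
Qed.

Lemma functional_mull L (g : T -> R) :
  measurable_fun [set: T] g -> (forall x, (0 <= g x)%R) ->
  integral_functional L ->
  integral_functional (fun f => L (fun x => (g x)%:E * f x)).
Proof.
move=> mg g0 hL.
have hM f : nonneg_measurable f -> nonneg_measurable (fun x => (g x)%:E * f x).
  move=> [mf f0]; split; last by move=> x; rewrite mule_ge0// lee_fin.
  by apply: emeasurable_funM => //; exact/measurable_EFinP.
split.
- by move=> f hf; apply: functional_ge0 => //; exact: hM.
- move=> f f' hf hf' ff'; apply: functional_le => //; [exact: hM|exact: hM|].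
  by move=> x; rewrite lee_wpmul2l// lee_fin.
- move=> f f' hf hf'; rewrite -functionalD//; [|exact: hM|exact: hM].
  by congr L; apply/funext => x; rewrite ge0_muleDr ?hf.2 ?hf'.2.
- move=> k f k0 hf; rewrite -functionalZ//; last exact: hM.
  by congr L; apply/funext => x; rewrite muleCA.
- move=> F hF ndF; rewrite -functional_lim//.
  + congr L; apply/funext => x; rewrite -limeMl//.
    by apply: ereal_nondecreasing_is_cvgn; exact: ndF.
  + by move=> n; exact: hM.
  + by move=> x m n mn; rewrite lee_wpmul2l ?lee_fin//; exact: ndF.
Qed.

End integral_functional.

Section functional_combinators.
Context d d' (S : measurableType d) (T : measurableType d') (R : realType).

Lemma functional_comp_integral (mu : {measure set S -> \bar R}) (D : set S)
    (L : S -> (T -> \bar R) -> \bar R) : measurable D ->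
  (forall x, integral_functional (L x)) ->
  (forall f, nonneg_measurable f -> measurable_fun [set: S] (L ^~ f)) ->
  integral_functional (fun f => \int[mu]_(x in D) L x f).
Proof.
move=> mD hL mL.
have L0 f x : nonneg_measurable f -> D x -> 0 <= L x f.
  by move=> hf _; exact: functional_ge0.
have mLD f : nonneg_measurable f -> measurable_fun D (L ^~ f).
  by move=> hf; apply: measurable_funTS; exact: mL.
split.
- by move=> f hf; apply: integral_ge0 => x Dx; exact: L0.
- move=> f g hf hg fg; apply: ge0_le_integral => //.
  + by move=> x Dx; exact: L0.
  + exact: mLD.
  + exact: mLD.
  + by move=> x _; exact: functional_le.
- move=> f g hf hg; rewrite -ge0_integralD//.
  + by apply: eq_integral => x _; exact: functionalD.
  + by move=> x; exact: L0.
  + exact: mLD.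
  + by move=> x; exact: L0.
  + exact: mLD.
- move=> k f k0 hf; rewrite -ge0_integralZl//.
  + by apply: eq_integral => x _; exact: functionalZ.
  + exact: mLD.
  + by move=> x; exact: L0.
- move=> F hF ndF; rewrite -monotone_convergence//.
  + by apply: eq_integral => x _; exact: functional_lim.
  + by move=> n; exact: mLD.
  + by move=> n x; exact: L0.
  + move=> x _ m n mn; apply: functional_le => // y; exact: ndF.
Qed.

Lemma functional_precomp (L : (S -> \bar R) -> \bar R) (h : S -> T) :
  measurable_fun [set: S] h -> integral_functional L ->
  integral_functional (fun f => L (f \o h)).
Proof.
move=> mh hL.
have hC f : nonneg_measurable f -> nonneg_measurable (f \o h).
  move=> [mf f0]; split; last by move=> x /=.
  exact: measurableT_comp.
split.
- by move=> f hf; apply: functional_ge0 => //; exact: hC.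
- move=> f f' hf hf' ff'; apply: functional_le => //; [exact: hC|exact: hC|].
  by move=> x /=.
- by move=> f f' hf hf'; rewrite -functionalD//; exact: hC.
- by move=> k f k0 hf; rewrite -functionalZ//; exact: hC.
- move=> F hF ndF; rewrite -functional_lim// => [n|x]; first exact: hC.
  exact: ndF.
Qed.

End functional_combinators.

(** * Densities, the expected posterior and the disintegration *)

Lemma ge0_integral_density d (T : measurableType d) (R : realType)
    (mu : {measure set T -> \bar R}) (g : T -> R)
    (mg : measurable_fun [set: T] g) (g0 : forall t, (0 <= g t)%R)
    (f : T -> \bar R) :
  measurable_fun [set: T] f -> (forall x, 0 <= f x) ->
  \int[density mu mg g0]_x f x = \int[mu]_x ((g x)%:E * f x).
Proof.
move=> mf f0; pose L1 (h : T -> \bar R) := \int[density mu mg g0]_x h x.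
pose L2 (h : T -> \bar R) := \int[mu]_x ((g x)%:E * h x).
apply: (@functional_ext _ _ _ L1 L2) => //.
- exact: functional_integral.
- by apply: functional_mull => //; exact: functional_integral.
- move=> A mA; rewrite /L1 /L2 integral_indic// setIT /= /density.
  rewrite integral_mkcond; apply: eq_integral => x _.
  by rewrite patchE indicE; case: ifP; rewrite ?mule1 ?mule0.
Qed.

Lemma density_null d (T : measurableType d) (R : realType)
    (mu : {measure set T -> \bar R}) (g : T -> R)
    (mg : measurable_fun [set: T] g) (g0 : forall t, (0 <= g t)%R) A :
  measurable A -> mu A = 0 -> density mu mg g0 A = 0.
Proof.
move=> mA muA; rewrite /density /=.
have mgA : measurable_fun A (fun t => (g t)%:E).
  by apply: measurable_funTS; exact/measurable_EFinP.
rewrite -(integral_abs_eq0 mA mgA muA).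
by apply: eq_integral => t _; rewrite gee0_abs// lee_fin.
Qed.

Section kernels.
Context d d' (X : measurableType d) (Theta : measurableType d') (R : realType).
Variables (P : R.-pker Theta ~> X) (Q : R.-pker X ~> Theta).

Lemma measurable_integral_pker (F : X * Theta -> \bar R) :
  measurable_fun [set: X * Theta] F -> (forall z, 0 <= F z) ->
  measurable_fun [set: X] (fun x => \int[Q x]_t F (x, t)).
Proof. by move=> mF F0; exact: measurable_fun_integral_sfinite_kernel. Qed.

Lemma ge0_integral_eaton eta (F : Theta -> \bar R) :
  measurable_fun [set: Theta] F -> (forall t, 0 <= F t) ->
  \int[eaton_kernel P Q eta]_t F t = \int[P eta]_x \int[Q x]_t F t.
Proof.
move=> mF F0; pose L1 (h : Theta -> \bar R) := \int[eaton_kernel P Q eta]_t h t.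
pose L2 (h : Theta -> \bar R) := \int[P eta]_x \int[Q x]_t h t.
apply: (@functional_ext _ _ _ L1 L2) => //.
- exact: functional_integral.
- apply: functional_comp_integral => // [x|h [mh h0]].
    exact: functional_integral.
  by apply: measurable_fun_integral_kernel => // U mU; exact: measurable_kernel.
- move=> A mA; rewrite /L1 /L2 integral_indic// setIT.
  by apply: eq_integral => x _; rewrite integral_indic// setIT.
Qed.

(** The posterior is assumed to disintegrate the joint law on measurable sets
    only; this is the same identity for functions, by which integrals of risks
    become integrals of posterior losses. *)
Lemma ge0_integral_disintegration (nu : {measure set Theta -> \bar R})
    (F : X * Theta -> \bar R) : formal_posterior P nu Q ->
  measurable_fun [set: X * Theta] F -> (forall z, 0 <= F z) ->
  \int[marginal P nu]_x \int[Q x]_t F (x, t) =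
  \int[nu]_t \int[P t]_x F (x, t).
Proof.
move=> PQ mF F0.
pose L1 (h : X * Theta -> \bar R) := \int[marginal P nu]_x \int[Q x]_t h (x, t).
pose L2 (h : X * Theta -> \bar R) := \int[nu]_t \int[P t]_x h (x, t).
apply: (@functional_ext _ _ _ L1 L2) => //.
- apply: functional_comp_integral => // [x|h [mh h0]].
    apply: (functional_precomp (pair1_measurable x)).
    exact: functional_integral.
  exact: measurable_integral_pker.
- apply: functional_comp_integral => // [t|h [mh h0]].
    apply: (functional_precomp (pair2_measurable t)).
    exact: functional_integral.
  apply: (@measurable_fun_integral_sfinite_kernel _ _ _ _ _ (fun z => h (z.2, z.1)) P) => //.
  by apply: (measurableT_comp mh); exact: measurable_swap.
- move=> A mA; rewrite /L1 /L2.
  transitivity (\int[marginal P nu]_x Q x (xsection A x)).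
    apply: eq_integral => x _.
    transitivity (\int[Q x]_t (\1_(xsection A x) t)%:E).
      by apply: eq_integral => t _ /=; rewrite !indicE mem_xsection.
    by rewrite integral_indic ?setIT//; exact: measurable_xsection.
  rewrite PQ//; apply: eq_integral => t _.
  transitivity (\int[P t]_x (\1_(ysection A t) x)%:E).
    by rewrite integral_indic ?setIT//; exact: measurable_ysection.
  by apply: eq_integral => x _ /=; rewrite !indicE mem_ysection.
Qed.

End kernels.

(** Inversion is not continuous at 0; on nonnegative functions it is the power
    function with exponent -1. *)
Lemma measurable_inv_ge0 d (T : measurableType d) (R : realType) (g : T -> R) :
  measurable_fun [set: T] g -> (forall t, (0 <= g t)%R) ->
  measurable_fun [set: T] (fun t => (g t)^-1)%R.
Proof.
move=> mg g0; rewrite (_ : (fun _ => _) = (@powR R ^~ (-1)) \o g)%R.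
  by apply: measurableT_comp => //; exact: measurable_powR.
by apply/funext => t /=; rewrite powR_inv1.
Qed.

(** * Avoidance probabilities of a Markov chain *)

Section avoidance.
Context d (S : measurableType d) (R : realType).
Variables (Tk : R.-pker S ~> S) (D : set S).
Hypothesis mD : measurable D.

(** The recursion is the first-step decomposition of the probability that the
    chain started at [x] is outside [D] at the times 1, ..., n; that it computes
    this probability is [avoid_prob].  Time 0 is left out on purpose: for [x] in
    [D] the limit is then the probability of never returning. *)
Fixpoint avoid (n : nat) (x : S) : R :=
  if n is m.+1 then fine (\int[Tk x]_(y in ~` D) (avoid m y)%:E) else 1%R.

Let mDC : measurable (~` D). Proof. exact: measurableC. Qed.

Lemma avoid_ge0 n x : (0 <= avoid n x)%R.
Proof.
elim: n x => [//|n ih x] /=.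
by apply: fine_ge0; apply: integral_ge0 => y _; rewrite lee_fin.
Qed.

Lemma measurable_avoid n : measurable_fun [set: S] (avoid n).
Proof.
elim: n => [|n ih] /=; first exact: measurable_cst.
apply: measurableT_comp => //.
under eq_fun do rewrite integral_mkcond.
apply: measurable_fun_integral_kernel.
- by move=> U mU; exact: measurable_kernel.
- by move=> y; apply: erestrict_ge0 => z _; rewrite lee_fin avoid_ge0.
- apply/(measurable_restrictT _ _).1 => //.
  by apply: measurable_funTS; exact/measurable_EFinP.
Qed.

Let integral_avoid_le1 n : (forall x, avoid n x <= 1)%R ->
  forall x, \int[Tk x]_(y in ~` D) (avoid n y)%:E <= 1.
Proof.
move=> ih x; apply: (@le_trans _ _ (\int[Tk x]_(y in ~` D) 1)).
  apply: ge0_le_integral => //.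
  - by move=> y _; rewrite lee_fin avoid_ge0.
  - by apply: measurable_funTS; exact/measurable_EFinP/measurable_avoid.
  - by move=> y _; rewrite lee_fin.
rewrite integral_cst// mul1e -(@prob_kernel _ _ _ _ _ Tk x).
by apply: le_measure; rewrite ?inE.
Qed.

Lemma avoid_le1 n x : (avoid n x <= 1)%R.
Proof.
elim: n x => [//|n ih x] /=.
rewrite -lee_fin fineK; first exact: integral_avoid_le1.
rewrite ge0_fin_numE; first exact: le_lt_trans (integral_avoid_le1 ih x) (ltry _).
by apply: integral_ge0 => y _; rewrite lee_fin avoid_ge0.
Qed.

Lemma avoidS n x :
  (avoid n.+1 x)%:E = \int[Tk x]_(y in ~` D) (avoid n y)%:E.
Proof.
rewrite /= fineK// ge0_fin_numE.
  exact: le_lt_trans (integral_avoid_le1 (avoid_le1 n) x) (ltry _).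
by apply: integral_ge0 => y _; rewrite lee_fin avoid_ge0.
Qed.

Lemma avoid_nonincreasing n x : (avoid n.+1 x <= avoid n x)%R.
Proof.
elim: n x => [|n ih] x; first exact: avoid_le1.
rewrite -lee_fin !avoidS; apply: ge0_le_integral => //.
- by move=> y _; rewrite lee_fin avoid_ge0.
- by apply: measurable_funTS; exact/measurable_EFinP/measurable_avoid.
- by apply: measurable_funTS; exact/measurable_EFinP/measurable_avoid.
- by move=> y _; rewrite lee_fin.
Qed.

End avoidance.

Section markov_property.
Context d d' (Omega : measurableType d') (S : measurableType d) (R : realType).
Variables (Tk : R.-pker S ~> S) (Pr : S -> probability Omega R).
Variable W : nat -> Omega -> S.
Hypothesis chainW : markov_chain (fun x => Tk x) Pr W.

Let mW n : measurable_fun [set: Omega] (W n).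
Proof. by case: chainW => + _ _; exact. Qed.

Lemma history_preimage n i A : (i <= n)%N -> measurable A ->
  history W n (W i @^-1` A).
Proof.
move=> ni mA; apply: sub_gen_smallest.
by exists i => //; exists A => //; rewrite setTI.
Qed.

Lemma measurable_history n E : history W n E -> measurable E.
Proof.
apply: smallest_sub; first exact: sigma_algebra_measurable.
move=> _ [i _] [A mA <-]; exact: mW.
Qed.

(** The definition of a Markov chain gives this for indicators [g]. *)
Lemma markov_property w n E g : history W n E ->
  measurable_fun [set: S] g -> (forall x, 0 <= g x) ->
  \int[Pr w]_(o in E) g (W n.+1 o) =
  \int[Pr w]_(o in E) \int[Tk (W n o)]_y g y.
Proof.
move=> hE mg g0; have mE := measurable_history hE.
pose L1 (h : S -> \bar R) := \int[Pr w]_(o in E) h (W n.+1 o).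
pose L2 (h : S -> \bar R) := \int[Pr w]_(o in E) \int[Tk (W n o)]_y h y.
apply: (@functional_ext _ _ _ L1 L2) => //.
- apply: (functional_precomp (L := fun f => \int[Pr w]_(o in E) f o) (mW n.+1)).
  exact: functional_integral.
- apply: functional_comp_integral => // [a|h [mh h0]].
    exact: functional_integral.
  apply: (@measurableT_comp _ _ _ _ _ _ (fun x => \int[Tk x]_y h y)) => //.
  by apply: measurable_fun_integral_kernel => // U mU; exact: measurable_kernel.
- move=> A mA; rewrite /L1 /L2.
  case: chainW => _ _ /(_ w n E A hE mA).
  have -> : (\int[Pr w]_(o in E) (EFin \o \1_A) (W n.+1 o)) =
      (\int[Pr w]_(o in E) (\1_(W n.+1 @^-1` A) o)%:E).
    by [].
  rewrite integral_indic//; last by rewrite -[X in measurable X]setTI; exact: mW.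
  move=> H; rewrite setIC; apply: (etrans H); apply: eq_integral => o _.
  by rewrite integral_indic// setIT.
Qed.

Variable D : set S.
Hypothesis mD : measurable D.

Fixpoint avoids (n : nat) : set Omega :=
  if n is m.+1 then avoids m `&` W m.+1 @^-1` (~` D) else [set: Omega].

Lemma history_avoids m n : (m <= n)%N -> history W n (avoids m).
Proof.
have [HT _ _ HI] := (@sigma_algebraP _ setT (history W n) (fun _ _ => @subsetT _ _)).1
  (smallest_sigma_algebra _ _).
elim: m => [_ //|m ih mn] /=; apply: HI; first exact: ih (ltnW mn).
by apply: history_preimage => //; exact: measurableC.
Qed.

Lemma measurable_avoids n : measurable (avoids n).
Proof. exact: measurable_history (history_avoids (leqnn n)). Qed.

Lemma integral_start w g : measurable_fun [set: S] g -> (forall x, 0 <= g x) ->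
  \int[Pr w]_o g (W 0%N o) = g w.
Proof.
move=> mg g0.
rewrite -[LHS](ge0_integral_pushforward (mW 0%N) (Pr w) measurableT mg)//.
rewrite (@eq_measure_integral _ _ _ _ (dirac w)).
  by rewrite integral_dirac// diracT mul1e.
by move=> A mA _; case: chainW => _ + _; exact.
Qed.

(** Induction on [n] moves one step at a time from the event to the function:
    by the Markov property, conditioning on the past of time [n] turns
    [avoid k] at time [n + 1] into [avoid k.+1] at time [n]. *)
Lemma integral_avoids w n k :
  \int[Pr w]_(o in avoids n) (avoid Tk D k (W n o))%:E =
  (avoid Tk D (n + k) w)%:E.
Proof.
have mav j : measurable_fun [set: S] (fun x => (avoid Tk D j x)%:E).
  by apply/measurable_EFinP; exact: measurable_avoid.
have av0 j x : 0 <= (avoid Tk D j x)%:E by rewrite lee_fin avoid_ge0.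
elim: n k => [|n ih] k.
  by rewrite (integral_start w (mav k)).
rewrite addSnnS -ih.
rewrite -[avoids n.+1]/(avoids n `&` W n.+1 @^-1` (~` D)).
pose g := (fun x => (avoid Tk D k x)%:E) \_ (~` D).
transitivity (\int[Pr w]_(o in avoids n) g (W n.+1 o)).
  rewrite integral_mkcond [RHS]integral_mkcond; apply: eq_integral => o _.
  rewrite /g !patchE in_setI.
  have -> : (o \in W n.+1 @^-1` (~` D)) = (W n.+1 o \in ~` D).
    by apply/idP/idP; rewrite !inE.
  by case: (o \in avoids n).
rewrite (markov_property w (history_avoids (leqnn n))).
- by apply: eq_integral => o _; rewrite avoidS// -integral_mkcond.
- apply/(measurable_restrictT _ _).1; first exact: measurableC.
  by apply: measurable_funTS.
- by move=> x; apply: erestrict_ge0.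
Qed.

Lemma avoid_prob w n : Pr w (avoids n) = (avoid Tk D n w)%:E.
Proof.
rewrite -[in RHS](addn0 n) -integral_avoids /= integral_cst ?mul1e//.
exact: measurable_avoids.
Qed.

(** The events [avoids n] decrease to the event of never returning to [D]. *)
Lemma cvg_avoid_recurrent w :
  Pr w [set o | exists2 n, (1 <= n)%N & D (W n o)] = 1 ->
  (avoid Tk D n w)%:E @[n --> \oo] --> 0.
Proof.
move=> hit1.
pose H := [set o | exists2 n, (1 <= n)%N & D (W n o)].
have avE : \bigcap_n avoids n = ~` H.
  apply/seteqP; split => [a hav [n n1 DW]|a nH n _].
    case: n n1 DW => // n _ DW.
    by have [_] := hav n.+1 Logic.I; exact.
  elim: n => [//|n ih] /=; split=> // DW.
  by apply: nH; exists n.+1.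
have mav n := measurable_avoids n.
have mcap : measurable (\bigcap_n avoids n) by exact: bigcap_measurable.
have mH : measurable H.
  by rewrite -[H]setCK -avE; exact: measurableC.
have : Pr w (avoids n) @[n --> \oo] --> Pr w (\bigcap_n avoids n).
  apply: nonincreasing_cvg_mu => //.
  - by rewrite /= (le_lt_trans (probability_le1 (Pr w) (mav 0%N)))// ltry.
  - apply/nonincreasing_seqP => n; apply/subsetPset => /= o []//.
under eq_fun do rewrite avoid_prob.
by rewrite avE probability_setC// hit1 subee.
Qed.

End markov_property.

(** * The Dirichlet form of a reversible chain *)

Lemma lee_of_balance (R : realDomainType) (e b c s : \bar R) :
  0 <= e -> 0 <= b -> c < +oo -> e + (b + b) = c + c -> c <= b + s ->
  e <= s + s.
Proof.
move=> e0 b0 coo bal cbs.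
have bfin : b \is a fin_num.
  rewrite ge0_fin_numE//; apply: (@le_lt_trans _ _ (c + c)); last exact: lte_add_pinfty.
  rewrite -bal (@le_trans _ _ (b + b))//; first exact: leeDl.
  exact: leeDr.
rewrite -(@leeD2rE _ (b + b)); last by rewrite fin_numD bfin.
by rewrite bal (le_trans (leeD cbs cbs))// addeACA addeC.
Qed.

Section energy.
Context d (S : measurableType d) (R : realType).
Variables (mu : {measure set S -> \bar R}) (Tk : R.-pker S ~> S).

Definition reversible : Prop := forall F : S * S -> \bar R,
  measurable_fun [set: S * S] F -> (forall z, 0 <= F z) ->
  \int[mu]_x \int[Tk x]_y F (x, y) = \int[mu]_x \int[Tk x]_y F (y, x).

Definition energy (v : S -> R) : \bar R :=
  \int[mu]_x \int[Tk x]_y ((v y - v x) ^+ 2)%:E.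

Hypothesis rev : reversible.

Let integral_cst_pker x (k : R) : \int[Tk x]_y k%:E = k%:E.
Proof. by rewrite integral_cst// prob_kernel mule1. Qed.

(** Expanding the square and using reversibility,
    [energy v = 2 int v^2 - 2 int v T v].  The hypothesis bounds the integrand
    [v^2 - v T v] by [s]; integrability of [v] makes the two integrals finite,
    so that they may be subtracted. *)
Lemma energy_le (v s : S -> R) :
  measurable_fun [set: S] v -> (forall x, (0 <= v x <= 1)%R) ->
  measurable_fun [set: S] s -> (forall x, (0 <= s x)%R) ->
  \int[mu]_x (v x)%:E < +oo ->
  (forall x, (v x ^+ 2)%:E <= \int[Tk x]_y (v x * v y)%:E + (s x)%:E) ->
  energy v <= \int[mu]_x (s x)%:E + \int[mu]_x (s x)%:E.
Proof.
move=> mv v01 ms s0 voo vTv.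
have v0 x : (0 <= v x)%R by case/andP: (v01 x).
have v1 x : (v x <= 1)%R by case/andP: (v01 x).
have mv1 : measurable_fun [set: S * S] (fun z => v z.1) by exact: measurableT_comp.
have mv2 : measurable_fun [set: S * S] (fun z => v z.2) by exact: measurableT_comp.
have mK (F : S * S -> R) : measurable_fun [set: S * S] F -> (forall z, (0 <= F z)%R) ->
    measurable_fun [set: S] (fun x => \int[Tk x]_y (F (x, y))%:E).
  move=> mF F0; apply: (@measurable_fun_integral_sfinite_kernel _ _ _ _ _ (EFin \o F) Tk).
    by move=> z; rewrite lee_fin.
  exact/measurable_EFinP.
have mP (F : S * S -> R) x : measurable_fun [set: S * S] F ->
    measurable_fun [set: S] (fun y => (F (x, y))%:E).
  by move=> mF; apply/measurable_EFinP; apply: (measurableT_comp mF); exact: pair1_measurable.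
pose prodv (z : S * S) := (v z.1 * v z.2)%R.
pose difv (z : S * S) := ((v z.2 - v z.1) ^+ 2)%R.
pose sq1 (z : S * S) := (v z.1 ^+ 2)%R.
pose sq2 (z : S * S) := (v z.2 ^+ 2)%R.
have mprod : measurable_fun [set: S * S] prodv by exact: measurable_funM.
have mdif : measurable_fun [set: S * S] difv.
  by apply: measurable_funX; exact: measurable_funB.
have msq1 : measurable_fun [set: S * S] sq1 by exact: measurable_funX.
have msq2 : measurable_fun [set: S * S] sq2 by exact: measurable_funX.
pose J (F : S * S -> R) := \int[mu]_x \int[Tk x]_y (F (x, y))%:E.
have JD (F G : S * S -> R) : measurable_fun [set: S * S] F -> (forall z, (0 <= F z)%R) ->
    measurable_fun [set: S * S] G -> (forall z, (0 <= G z)%R) ->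
    J (fun z => F z + G z)%R = J F + J G.
  move=> mF F0 mG G0; rewrite /J -ge0_integralD//; last 4 first.
  - by move=> x _; apply: integral_ge0 => y _; rewrite lee_fin.
  - exact: mK.
  - by move=> x _; apply: integral_ge0 => y _; rewrite lee_fin.
  - exact: mK.
  apply: eq_integral => x _; rewrite -ge0_integralD//.
  - by move=> y _; rewrite lee_fin.
  - exact: mP.
  - by move=> y _; rewrite lee_fin.
  - exact: mP.
have p0 z : (0 <= prodv z)%R by exact: mulr_ge0.
have d0 z : (0 <= difv z)%R by exact: sqr_ge0.
have s10 z : (0 <= sq1 z)%R by exact: sqr_ge0.
have s20 z : (0 <= sq2 z)%R by exact: sqr_ge0.
have Jsq2 : J sq2 = J sq1.
  by rewrite /J (rev (F := EFin \o sq2))//; exact/measurable_EFinP.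
have Jsq1 : J sq1 = \int[mu]_x (v x ^+ 2)%:E.
  by apply: eq_integral => x _; rewrite /sq1 /= integral_cst_pker.
have Jsplit : J difv + (J prodv + J prodv) = J sq1 + J sq1.
  have m2p : measurable_fun [set: S * S] (fun z => prodv z + prodv z)%R.
    exact: measurable_funD.
  have p20 z : (0 <= prodv z + prodv z)%R by exact: addr_ge0.
  have Jpp := JD _ _ mprod p0 mprod p0; have Jdpp := JD _ _ mdif d0 m2p p20.
  have J12 := JD _ _ msq1 s10 msq2 s20.
  apply: (etrans (congr1 (adde (J difv)) (esym Jpp))); apply: (etrans (esym Jdpp)).
  apply: (etrans _ (congr1 (adde (J sq1)) Jsq2)); apply: (etrans _ J12).
  apply: eq_integral => x _; apply: eq_integral => y _.
  by rewrite /difv /prodv /sq1 /sq2 /=; congr (_%:E); ring.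
have Jsq1_oo : J sq1 < +oo.
  rewrite Jsq1; apply: le_lt_trans voo; apply: ge0_le_integral.
  - exact: measurableT.
  - by move=> x _; rewrite lee_fin sqr_ge0.
  - by apply/measurable_EFinP; exact: measurable_funX.
  - exact/measurable_EFinP.
  - by move=> x _; rewrite lee_fin expr2 ler_piMr.
have J0 F : (forall z, (0 <= F z)%R) -> 0 <= J F.
  by move=> F0; apply: integral_ge0 => x _; apply: integral_ge0 => y _; rewrite lee_fin.
have Jle : J sq1 <= J prodv + \int[mu]_x (s x)%:E.
  have mJp : measurable_fun [set: S] (fun x => \int[Tk x]_y (prodv (x, y))%:E).
    exact: mK.
  have Jp0 x : 0 <= \int[Tk x]_y (prodv (x, y))%:E.
    by apply: integral_ge0 => y _; rewrite lee_fin.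
  have ms' : measurable_fun [set: S] (fun x => (s x)%:E) by exact/measurable_EFinP.
  have s0' x : 0 <= (s x)%:E by rewrite lee_fin.
  rewrite Jsq1 /J -(ge0_integralD mu measurableT (fun x _ => Jp0 x) mJp (fun x _ => s0' x) ms').
  apply: ge0_le_integral.
  - exact: measurableT.
  - by move=> x _; rewrite lee_fin sqr_ge0.
  - by apply/measurable_EFinP; exact: measurable_funX.
  - exact: emeasurable_funD.
  - by move=> x _; exact: vTv.
exact: (lee_of_balance (J0 _ d0) (J0 _ p0) Jsq1_oo Jsplit Jle).
Qed.

Variable D : set S.
Hypothesis mD : measurable D.

(** The probability that the chain started at [x] visits [D] at one of the
    times 0, ..., n.  The truncation to a finite horizon keeps it integrable. *)
Definition hit (n : nat) (x : S) : R := (1 - \1_(~` D) x * avoid Tk D n x)%R.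

Let mind A : measurable A -> measurable_fun [set: S] (\1_A : S -> R).
Proof. by move=> mA; exact: measurable_indic. Qed.

Let mavD n : measurable_fun [set: S] (fun x => \1_(~` D) x * avoid Tk D n x)%R.
Proof.
by apply: measurable_funM; [exact/mind/measurableC|exact: measurable_avoid].
Qed.

Lemma measurable_hit n : measurable_fun [set: S] (hit n).
Proof. exact: measurable_funB. Qed.

Lemma hit01 n x : (0 <= hit n x <= 1)%R.
Proof.
have := avoid_ge0 Tk D n x; have := avoid_le1 Tk mD n x.
by rewrite /hit indicE; case: (x \in ~` D) => /= a1 a0; lra.
Qed.

Lemma hit_eq1 n x : D x -> hit n x = 1%R.
Proof.
move=> Dx; rewrite /hit indicE memNset ?mul0r ?subr0//.
Qed.

Lemma integral_hit n x :
  \int[Tk x]_y (hit n y)%:E = (1 - avoid Tk D n.+1 x)%:E.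
Proof.
have av0 y : (0 <= \1_(~` D) y * avoid Tk D n y)%R.
  by rewrite mulr_ge0 ?avoid_ge0.
have avE : (avoid Tk D n.+1 x)%:E = \int[Tk x]_y (\1_(~` D) y * avoid Tk D n y)%:E.
  rewrite avoidS// integral_mkcond; apply: eq_integral => y _.
  by rewrite patchE indicE; case: ifP => _; rewrite ?mul1r ?mul0r.
have hitD : \int[Tk x]_y (hit n y)%:E + (avoid Tk D n.+1 x)%:E = 1.
  rewrite avE -ge0_integralD//; last 4 first.
  - by move=> y _; rewrite lee_fin; have /andP[] := hit01 n y.
  - exact/measurable_EFinP/measurable_hit.
  - by move=> y _; rewrite lee_fin.
  - exact/measurable_EFinP.
  rewrite -[RHS](integral_cst_pker x 1); apply: eq_integral => y _.
  by rewrite -EFinD /hit subrK.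
by rewrite EFinB -hitD addeK.
Qed.

(** On [D] both sides are equal to 1.  Off [D],
    [T (hit n) = hit n.+1 >= hit n] because avoidance probabilities decrease
    with [n]. *)
Lemma hit_sq_le n x :
  (hit n x ^+ 2)%:E <= \int[Tk x]_y (hit n x * hit n y)%:E +
                       (\1_D x * avoid Tk D n.+1 x)%:E.
Proof.
have -> : \int[Tk x]_y (hit n x * hit n y)%:E =
    (hit n x * (1 - avoid Tk D n.+1 x))%:E.
  under eq_integral do rewrite EFinM.
  rewrite ge0_integralZl ?integral_hit//.
  - exact/measurable_EFinP/measurable_hit.
  - by move=> y _; rewrite lee_fin; have /andP[] := hit01 n y.
  - by rewrite lee_fin; have /andP[] := hit01 n x.
rewrite -EFinD lee_fin.
have [Dx|nDx] := pselect (D x).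
  by rewrite hit_eq1// indicE mem_set//= expr1n; lra.
have := hit01 n x; have := avoid_nonincreasing Tk mD n x.
rewrite /hit !indicE mem_set//= memNset//=; nra.
Qed.

(** [hit 0] is the indicator of [D], [hit n.+1 <= 1_D + T (hit n)], and [T]
    preserves integrals with respect to the reversing measure. *)
Lemma integral_hit_lt_pinfty n : mu D < +oo -> \int[mu]_x (hit n x)%:E < +oo.
Proof.
move=> muD; have h0 m x : 0 <= (hit m x)%:E.
  by rewrite lee_fin; have /andP[] := hit01 m x.
have mh m : measurable_fun [set: S] (EFin \o hit m).
  exact/measurable_EFinP/measurable_hit.
elim: n => [|n ih].
  suff -> : \int[mu]_x (hit 0 x)%:E = \int[mu]_x (\1_D x)%:E.
    by rewrite integral_indic// setIT.
  apply: eq_integral => x _.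
  by rewrite /hit mulr1 !indicE in_setC; case: (x \in D); rewrite /= ?subr0 ?subrr.
have hitS x : (hit n.+1 x)%:E <= (\1_D x)%:E + \int[Tk x]_y (hit n y)%:E.
  rewrite integral_hit -EFinD lee_fin /hit !indicE in_setC.
  have := avoid_ge0 Tk D n.+1 x; have := avoid_le1 Tk mD n.+1 x.
  by case: (x \in D) => /=; lra.
have mT : measurable_fun [set: S] (fun x => \int[Tk x]_y (hit n y)%:E).
  apply: measurable_fun_integral_kernel; [|exact: h0|exact: mh].
  by move=> U mU; exact: measurable_kernel.
apply: (@le_lt_trans _ _ (\int[mu]_x ((\1_D x)%:E + \int[Tk x]_y (hit n y)%:E))).
  apply: ge0_le_integral.
  - exact: measurableT.
  - by move=> x _; exact: h0.
  - exact: mh.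
  - by apply: emeasurable_funD => //; exact/measurable_EFinP/mind.
  - by move=> x _; exact: hitS.
rewrite (ge0_integralD _ measurableT); last 4 first.
- by move=> x _; rewrite lee_fin.
- exact/measurable_EFinP/mind.
- by move=> x _; exact: integral_ge0.
- exact: mT.
rewrite integral_indic// setIT lte_add_pinfty//.
rewrite (rev (F := fun z => (hit n z.2)%:E)); last 2 first.
- by apply: (measurableT_comp (mh n)); exact: measurable_snd.
- by move=> z; exact: h0.
rewrite (eq_integral (fun x => (hit n x)%:E))// => x _.
by rewrite /= integral_cst_pker.
Qed.

Lemma energy_hit_le n :
  mu D < +oo -> energy (hit n) <=
    \int[mu]_(x in D) (avoid Tk D n.+1 x)%:E +
    \int[mu]_(x in D) (avoid Tk D n.+1 x)%:E.
Proof.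
move=> muD.
have -> : \int[mu]_(x in D) (avoid Tk D n.+1 x)%:E =
    \int[mu]_x (\1_D x * avoid Tk D n.+1 x)%:E.
  rewrite integral_mkcond; apply: eq_integral => x _.
  by rewrite patchE indicE; case: ifP => _; rewrite ?mul1r ?mul0r.
apply: energy_le.
- exact: measurable_hit.
- exact: hit01.
- by apply: measurable_funM; [exact: mind|exact: measurable_avoid].
- by move=> x; rewrite mulr_ge0 ?avoid_ge0.
- exact: integral_hit_lt_pinfty.
- exact: hit_sq_le.
Qed.

Lemma energy_hit_cvg0 : mu D < +oo ->
  {ae mu, forall x, D x -> (avoid Tk D n x)%:E @[n --> \oo] --> 0} ->
  energy (hit n) @[n --> \oo] --> 0.
Proof.
move=> muD av0.
have mav n : measurable_fun D (fun x => (avoid Tk D n x)%:E).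
  by apply: measurable_funTS; exact/measurable_EFinP/measurable_avoid.
have [_ _ cv] : [/\ mu.-integrable D (cst 0),
   \int[mu]_(x in D) `|(avoid Tk D n x)%:E - 0| @[n --> \oo] --> 0 &
   \int[mu]_(x in D) (avoid Tk D n x)%:E @[n --> \oo] --> \int[mu]_(x in D) (cst 0 x)].
  apply: (@dominated_convergence _ _ _ mu D mD _ (cst 0) (cst 1)) => //.
  - apply/integrableP; split=> //.
    under eq_integral do rewrite /= normr1.
    by rewrite integral_cst// mul1e.
  - apply: aeW => x Dx n.
    by rewrite gee0_abs ?lee_fin ?avoid_ge0// avoid_le1.
rewrite integral0 in cv.
have cvS : \int[mu]_(x in D) (avoid Tk D n.+1 x)%:E @[n --> \oo] --> 0.
  by rewrite (cvg_shiftS (fun n => \int[mu]_(x in D) (avoid Tk D n x)%:E)).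
apply: (@squeeze_cvge _ _ _ _ (fun=> 0) _ (fun n =>
  \int[mu]_(x in D) (avoid Tk D n.+1 x)%:E + \int[mu]_(x in D) (avoid Tk D n.+1 x)%:E)).
- near=> n; apply/andP; split; last exact: energy_hit_le.
  by apply: integral_ge0 => x _; apply: integral_ge0 => y _; rewrite lee_fin sqr_ge0.
- exact: cvg_cst.
- by rewrite -[X in _ --> X]adde0; apply: cvgeD.
Unshelve. all: by end_near. Qed.

End energy.

(** * Quadratic loss and reweighting, in dimension one *)

Section quadratic_loss.
Context d (T : measurableType d) (R : realType) (pi : probability T R).
Implicit Types f g phi v : T -> R.

Local Notation integ f := (pi.-integrable [set: T] (EFin \o f)).
Local Notation E f := (\int[pi]_x f x)%R.

Let integ_cst (c : R) : integ (cst c).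
Proof. exact: finite_measure_integrable_cst. Qed.

Let E_cst (c : R) : E (cst c) = c.
Proof.
rewrite Rintegral_cst// -[RHS]mulr1; congr (_ * _)%R.
exact: (congr1 fine (probability_setT pi)).
Qed.

Lemma integrable_comb (a b : R) f g : integ f -> integ g ->
  integ (fun x => a * f x + b * g x)%R.
Proof.
move=> hf hg.
have := integrableD measurableT (integrableZl measurableT a hf)
  (integrableZl measurableT b hg).
by apply: eq_integrable => // x _ /=; rewrite EFinD !EFinM.
Qed.

Lemma Rintegral_comb (a b : R) f g : integ f -> integ g ->
  E (fun x => a * f x + b * g x)%R = (a * E f + b * E g)%R.
Proof.
move=> hf hg.
have hZ (k : R) h : integ h -> integ (fun x => k * h x)%R.
  move=> /(integrableZl measurableT k).
  by apply: eq_integrable => // x _ /=; rewrite EFinM.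
rewrite -!RintegralZl//.
by rewrite -RintegralD//; exact: hZ.
Qed.

Lemma Rintegral_le_ge0 f (g : T -> \bar R) : integ f ->
  measurable_fun [set: T] g -> (forall x, 0 <= g x) ->
  (forall x, (f x)%:E <= g x) -> (E f)%:E <= \int[pi]_x g x.
Proof.
move=> hf mg g0 fg.
have [goo|] := ltP (\int[pi]_x g x) +oo; last by rewrite leye_eq => /eqP ->; rewrite leey.
rewrite /Rintegral fineK; last exact: integrable_fin_num.
apply: le_integral => //.
apply/integrableP; split=> //.
by under eq_integral do rewrite gee0_abs//.
Qed.

Lemma integrable_of_sq f (c : R) : measurable_fun [set: T] f ->
  \int[pi]_x ((f x - c) ^+ 2)%:E < +oo ->
  integ f /\ integ (fun x => f x ^+ 2)%R.
Proof.
move=> mf foo.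
have hsq : integ (fun x => (f x - c) ^+ 2)%R.
  apply/integrableP; split.
    by apply/measurable_EFinP; apply: measurable_funX; exact: measurable_funB.
  by under eq_integral do rewrite /= ger0_norm ?sqr_ge0//.
have hb : integ (fun x => 1 * (f x - c) ^+ 2 + (1 + `|c|) * 1)%R.
  by apply: (integrable_comb _ _ hsq (integ_cst 1)).
have hf : integ f.
  apply: le_integrable hb => //; first exact/measurable_EFinP.
  move=> x _ /=; rewrite lee_fin.
  have h1 : (`|f x| <= `|f x - c| + `|c|)%R.
    by rewrite -{1}(subrK c (f x)) ler_normD.
  have h2 : (`|f x - c| <= 1 + (f x - c) ^+ 2)%R.
    by rewrite -(real_normK (num_real (f x - c)%R)); have := normr_ge0 (f x - c)%R; nra.
  by apply: le_trans (ler_norm _); lra.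
split=> //.
have := integrable_comb 1 (2 * c) hsq (integrable_comb 1 (- (c / 2)) hf (integ_cst 1)).
by apply: eq_integrable => // x _ /=; congr (_%:E); field.
Qed.

(** Jensen's inequality for the square.  An infinite right-hand side makes the
    bound trivial; otherwise [phi] is square integrable. *)
Lemma sq_sub_Rintegral_le phi (b : R) : measurable_fun [set: T] phi ->
  ((b - E phi) ^+ 2)%:E <= \int[pi]_x ((b - phi x) ^+ 2)%:E.
Proof.
move=> mphi.
have [|] := ltP (\int[pi]_x ((b - phi x) ^+ 2)%:E) +oo; last first.
  by rewrite leye_eq => /eqP ->; rewrite leey.
under eq_integral do rewrite -sqrrN opprB.
move=> /(integrable_of_sq mphi)[h1 _].
pose l x := (2 * (E phi - b) * phi x + (b ^+ 2 - E phi ^+ 2) * cst 1 x)%R.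
have -> : ((b - E phi) ^+ 2)%R = E l.
  by rewrite Rintegral_comb// E_cst; ring.
apply: Rintegral_le_ge0.
- exact: integrable_comb.
- apply/measurable_EFinP; apply: measurable_funX; exact: measurable_funB.
- by move=> x; rewrite lee_fin sqr_ge0.
- move=> x; rewrite lee_fin /l /=.
  by have := sqr_ge0 (phi x - E phi)%R; nra.
Qed.

(** Put [h = v^2] and [e = a - E phi].  For all [x], [y],
      e (phi x - phi y) (h x - h y) - e^2 (h x + h y) / 2
        <= (phi x - phi y)^2 (v x - v y)^2:
    use [p q - p^2 / 4 <= q^2] with [p = e (v x + v y)] and
    [q = (phi x - phi y) (v x - v y)], then [(v x + v y)^2 <= 2 (h x + h y)].
    Integrating the left-hand side in [x] and then in [y] gives
    [2 e (E (phi h) - E phi E h) - e^2 E h], which is exactly the difference of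
    the two weighted losses.  This replaces the comparison with the Bayes
    estimator for the weight [h] that is usual in Blyth's method, and avoids
    dividing by [E h]. *)
Lemma quadratic_loss_perturbation phi v (a c : R) :
  measurable_fun [set: T] phi -> measurable_fun [set: T] v ->
  (forall x, (0 <= v x <= 1)%R) ->
  \int[pi]_x ((phi x - c) ^+ 2)%:E < +oo ->
  \int[pi]_x ((phi x - E phi) ^+ 2 * v x ^+ 2)%:E <=
  \int[pi]_x ((phi x - a) ^+ 2 * v x ^+ 2)%:E +
  \int[pi]_y \int[pi]_x ((phi x - phi y) ^+ 2 * (v x - v y) ^+ 2)%:E.
Proof.
move=> mphi mv v01 phioo.
have [h1 h2] := integrable_of_sq mphi phioo.
pose h x := (v x ^+ 2)%R.
have mh : measurable_fun [set: T] h by exact: measurable_funX.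
have hle1 x : (`|h x| <= 1)%R.
  have /andP[v0 v1] := v01 x; rewrite ger0_norm ?sqr_ge0//.
  by rewrite /h expr2 mulr_ile1.
have mulh f : integ f -> integ (fun x => f x * h x)%R.
  move=> hf; have [mf _] := integrableP _ _ _ hf.
  apply: le_integrable hf => //.
    by apply/measurable_EFinP; apply: measurable_funM => //; exact/measurable_EFinP.
  by move=> x _; rewrite /= lee_fin normrM ler_piMr.
have hh : integ h.
  have := mulh _ (integ_cst 1); apply: eq_integrable => // x _ /=.
  by rewrite mul1r.
have h1h := mulh _ h1; have h2h := mulh _ h2.
set m0 := E h; set m1 := E (fun x => phi x * h x)%R.
set m2 := E (fun x => phi x ^+ 2 * h x)%R; set del := E phi.
have integ_loss b : integ (fun x => (phi x - b) ^+ 2 * h x)%R.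
  have := integrable_comb 1 1 h2h (integrable_comb (- (2 * b)) (b ^+ 2) h1h hh).
  by apply: eq_integrable => // x _ /=; congr (_%:E); ring.
have loss b : E (fun x => (phi x - b) ^+ 2 * h x)%R =
    (m2 - 2 * b * m1 + b ^+ 2 * m0)%R.
  transitivity (1 * m2 + 1 * (- (2 * b) * m1 + b ^+ 2 * m0))%R; last by ring.
  rewrite /m0 /m1 /m2 -Rintegral_comb// -Rintegral_comb//; last exact: integrable_comb.
  by apply: eq_Rintegral => x _; ring.
have lossE b : \int[pi]_x ((phi x - b) ^+ 2 * v x ^+ 2)%:E =
    (m2 - 2 * b * m1 + b ^+ 2 * m0)%:E.
  by rewrite -loss /Rintegral fineK//; exact: integrable_fin_num (integ_loss b).
rewrite !lossE.
pose G (z : T * T) := ((phi z.1 - phi z.2) ^+ 2 * (v z.1 - v z.2) ^+ 2)%R.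
have mG : measurable_fun [set: T * T] (EFin \o G).
  apply/measurable_EFinP; apply: measurable_funM; apply: measurable_funX;
    apply: measurable_funB; exact: measurableT_comp.
have G0 z : (0 <= G z)%R by rewrite mulr_ge0 ?sqr_ge0.
(* [L y] is the integral in [x] of the left-hand side of the pointwise
   inequality. *)
pose dd := (a - del)%R.
pose L y := (dd * (m1 - phi y * m0 - h y * del + phi y * h y)
             - dd ^+ 2 / 2 * (m0 + h y))%R.
have LJ y : (L y)%:E <= \int[pi]_x (EFin \o G) (x, y).
  pose l x := (1 * ((- dd * phi y - dd ^+ 2 / 2) * h x + dd * (phi x * h x)) +
    1 * ((- dd * h y) * phi x + (dd * phi y * h y - dd ^+ 2 / 2 * h y) * cst 1 x))%R.
  have -> : L y = E l.
    rewrite Rintegral_comb; [|exact: integrable_comb|exact: integrable_comb].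
    rewrite !Rintegral_comb// E_cst -/m0 -/m1 -/del /L; ring.
  apply: Rintegral_le_ge0.
  - by apply: integrable_comb; exact: integrable_comb.
  - by apply: (measurableT_comp mG); exact: pair2_measurable.
  - by move=> x; rewrite lee_fin.
  - move=> x; rewrite lee_fin /l /G /h /=.
    set A := (phi x - phi y)%R; set s := v x; set t := v y.
    (* These two squares are the slack in the two estimates that the pointwise
       inequality combines. *)
    have := sqr_ge0 (A * (s - t) - dd / 2 * (s + t))%R.
    have := sqr_ge0 (dd * (s - t))%R.
    rewrite /A; nra.
have EL : E L = (2 * dd * (m1 - del * m0) - dd ^+ 2 * m0)%R.
  pose l y := (1 * ((- dd * del - dd ^+ 2 / 2) * h y + dd * (phi y * h y)) +
    1 * ((- dd * m0) * phi y + (dd * m1 - dd ^+ 2 / 2 * m0) * cst 1 y))%R.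
  transitivity (E l).
    by apply: eq_Rintegral => y _; rewrite /L /l /=; ring.
  rewrite Rintegral_comb; [|exact: integrable_comb|exact: integrable_comb].
  by rewrite !Rintegral_comb// E_cst -/m0 -/m1 -/del; field.
have iL : integ L.
  have := integrable_comb 1 1
    (integrable_comb (- dd * del - dd ^+ 2 / 2) dd hh h1h)
    (integrable_comb (- dd * m0) (dd * m1 - dd ^+ 2 / 2 * m0) h1 (integ_cst 1)).
  by apply: eq_integrable => // y _ /=; congr (_%:E); rewrite /L; ring.
have : (E L)%:E <= \int[pi]_y \int[pi]_x (EFin \o G) (x, y).
  apply: Rintegral_le_ge0 => //.
  - exact: measurable_fun_fubini_tonelli_G.
  - by move=> y; apply: integral_ge0 => x _; rewrite lee_fin.
rewrite EL => ELJ.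
rewrite -leeBlDl// -EFinB (le_trans _ ELJ)// lee_fin /dd; nra.
Qed.

End quadratic_loss.

(** * The posterior under a bounded perturbation of the prior *)

Section measurable_sqdist.
Context d (T : measurableType d) (R : realType) (p : nat).

Lemma sqdist_ge0 (x y : p.-tuple R) : (0 <= sqdist x y)%R.
Proof. by apply: sumr_ge0 => i _; exact: sqr_ge0. Qed.

Lemma measurable_sqdist (f g : T -> p.-tuple R) :
  measurable_fun [set: T] f -> measurable_fun [set: T] g ->
  measurable_fun [set: T] (fun x => sqdist (f x) (g x)).
Proof.
move=> /measurable_fun_tnthP mf /measurable_fun_tnthP mg.
apply: measurable_sum => i; apply: measurable_funX; apply: measurable_funB.
  exact: mf.
exact: mg.
Qed.

End measurable_sqdist.

Section vector_loss.
Context d (T : measurableType d) (R : realType) (pi : probability T R).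
Variables (p : nat) (phi : T -> p.-tuple R).
Hypothesis mphi : measurable_fun [set: T] phi.

Let mphii i : measurable_fun [set: T] (fun x => tnth (phi x) i).
Proof. by move/measurable_fun_tnthP : mphi; exact. Qed.

Lemma sqdist_mean_le (b : p.-tuple R) :
  (sqdist b (mean pi phi))%:E <= \int[pi]_x (sqdist b (phi x))%:E.
Proof.
rewrite /sqdist -sumEFin.
under eq_integral do rewrite -sumEFin.
rewrite ge0_integral_sum//.
- apply: lee_sum => i _; rewrite tnth_mktuple.
  exact: sq_sub_Rintegral_le.
- by move=> i; apply/measurable_EFinP; apply: measurable_funX; exact: measurable_funB.
- by move=> i x _; rewrite lee_fin sqr_ge0.
Qed.

Lemma sqdist_loss_perturbation (v : T -> R) (a b : p.-tuple R) :
  measurable_fun [set: T] v -> (forall x, (0 <= v x <= 1)%R) ->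
  \int[pi]_x (sqdist (phi x) b)%:E < +oo ->
  \int[pi]_x (sqdist (phi x) (mean pi phi) * v x ^+ 2)%:E <=
  \int[pi]_x (sqdist (phi x) a * v x ^+ 2)%:E +
  \int[pi]_y \int[pi]_x (sqdist (phi x) (phi y) * (v x - v y) ^+ 2)%:E.
Proof.
move=> mv v01 phioo.
have sumE (c : p.-tuple R) (w : T -> R) : measurable_fun [set: T] w ->
    \int[pi]_x (sqdist (phi x) c * w x ^+ 2)%:E =
    \sum_(i < p) \int[pi]_x ((tnth (phi x) i - tnth c i) ^+ 2 * w x ^+ 2)%:E.
  move=> mw; rewrite -ge0_integral_sum//.
  - by apply: eq_integral => x _; rewrite /sqdist mulr_suml sumEFin.
  - move=> i; apply/measurable_EFinP; apply: measurable_funM.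
      by apply: measurable_funX; exact: measurable_funB.
    exact: measurable_funX.
  - by move=> i x _; rewrite lee_fin mulr_ge0 ?sqr_ge0.
have mvy y : measurable_fun [set: T] (fun x => v x - v y)%R by exact: measurable_funB.
have mphi2 i : measurable_fun [set: T * T]
    (fun z => (tnth (phi z.2) i - tnth (phi z.1) i) ^+ 2 * (v z.2 - v z.1) ^+ 2 : R)%R.
  apply: measurable_funM; apply: measurable_funX; apply: measurable_funB.
  - exact: measurableT_comp (mphii i) measurable_snd.
  - exact: measurableT_comp (mphii i) measurable_fst.
  - exact: measurableT_comp mv measurable_snd.
  - exact: measurableT_comp mv measurable_fst.
under [X in _ <= _ + X]eq_integral => y _ do rewrite sumE//.
rewrite !sumE// ge0_integral_sum//; last 2 first.
- move=> i.
  apply: (@measurable_fun_fubini_tonelli_F _ _ _ _ _ pi (fun z =>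
    ((tnth (phi z.2) i - tnth (phi z.1) i) ^+ 2 * (v z.2 - v z.1) ^+ 2)%:E)).
    exact/measurable_EFinP.
  by move=> z; rewrite lee_fin mulr_ge0 ?sqr_ge0.
- by move=> i y _; apply: integral_ge0 => x _; rewrite lee_fin mulr_ge0 ?sqr_ge0.
rewrite -big_split /=; apply: lee_sum => i _; rewrite tnth_mktuple.
apply: (@quadratic_loss_perturbation _ _ _ pi _ _ _ (tnth b i)) => //.
apply: le_lt_trans phioo; apply: ge0_le_integral => //.
- by move=> x _; rewrite lee_fin sqr_ge0.
- by apply/measurable_EFinP; apply: measurable_funX; exact: measurable_funB.
- by apply/measurable_EFinP; exact: measurable_sqdist.
- move=> x _; rewrite lee_fin /sqdist (bigD1 i)//= lerDl.
  by apply: sumr_ge0 => j _; exact: sqr_ge0.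
Qed.

End vector_loss.

(** The lemmas on means above are about bundled probability measures; this
    bundles a posterior given as a measure of total mass 1. *)
Section as_probability.
Context d (T : measurableType d) (R : realType).
Variables (m : {measure set T -> \bar R}) (m1 : m [set: T] = 1).

Definition as_probability : set T -> \bar R := let _ := m1 in m.

HB.instance Definition _ := Measure.on as_probability.
HB.instance Definition _ :=
  Measure_isProbability.Build _ _ _ as_probability m1.

End as_probability.

Section perturbed_posterior.
Context d (T : measurableType d) (R : realType) (u : bounded_weight T R).
Variable c : R.
Hypotheses (c1 : (1 < c)%R) (uc : forall t, (c^-1 < u t < c)%R).

Let c0 : (0 < c)%R. Proof. exact: lt_trans c1. Qed.

Section fixed.
Variable q : {measure set T -> \bar R}.
Hypothesis q1 : q [set: T] = 1.

Let mu_E : measurable_fun [set: T] (EFin \o u).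
Proof. exact/measurable_EFinP/measurable_weight. Qed.

Lemma integral_weight_bounds :
  c^-1%:E <= \int[q]_t (u t)%:E <= c%:E.
Proof.
apply/andP; split.
  rewrite -[leLHS]mule1 -q1 -integral_cst//; apply: ge0_le_integral => //.
  - by move=> t _; rewrite lee_fin invr_ge0 ltW.
  - by move=> t _; rewrite lee_fin; have /andP[/ltW] := uc t.
rewrite -[leRHS]mule1 -q1 -integral_cst//; apply: ge0_le_integral => //.
- by move=> t _; rewrite lee_fin ltW// weight_gt0.
- by move=> t _; rewrite lee_fin; have /andP[_ /ltW] := uc t.
Qed.

Lemma hat_weightE : (hat_weight u q)%:E = \int[q]_t (u t)%:E.
Proof.
have /andP[_ h] := integral_weight_bounds.
rewrite /hat_weight /Rintegral fineK// ge0_fin_numE ?(le_lt_trans h) ?ltry//.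
by apply: integral_ge0 => t _; rewrite lee_fin ltW// weight_gt0.
Qed.

Lemma hat_weight_bounds : (c^-1 <= hat_weight u q <= c)%R.
Proof. by rewrite -!lee_fin hat_weightE; exact: integral_weight_bounds. Qed.

Let hat_gt0 : (0 < hat_weight u q)%R.
Proof. by have /andP[+ _] := hat_weight_bounds; apply: lt_le_trans; rewrite invr_gt0. Qed.

Lemma ge0_integral_perturbed F : measurable_fun [set: T] F -> (forall t, 0 <= F t) ->
  \int[perturbed_posterior u q]_t F t =
  \int[q]_t ((u t / hat_weight u q)%:E * F t).
Proof. by move=> mF F0; rewrite ge0_integral_density. Qed.

Lemma hat_weight_integral_perturbed F :
  measurable_fun [set: T] F -> (forall t, 0 <= F t) ->
  (hat_weight u q)%:E * \int[perturbed_posterior u q]_t F t =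
  \int[q]_t ((u t)%:E * F t).
Proof.
move=> mF F0; rewrite ge0_integral_perturbed// -ge0_integralZl//.
- apply: eq_integral => t _; rewrite muleA -EFinM mulrCA divff ?mulr1//.
  by rewrite gt_eqF.
- apply: emeasurable_funM => //; apply/measurable_EFinP.
  exact: measurable_normalized_weight.
- by move=> t _; rewrite mule_ge0// lee_fin normalized_weight_ge0.
- by rewrite lee_fin ltW.
Qed.

Lemma perturbed_posterior1 : perturbed_posterior u q [set: T] = 1.
Proof.
have := hat_weight_integral_perturbed (F := cst 1) (measurable_cst _) (fun=> lee01).
rewrite integral_cst// mul1e.
under eq_integral do rewrite mule1.
rewrite -hat_weightE => h.
have /(congr1 (fun z => ((hat_weight u q)^-1)%:E * z)) := h.
by rewrite muleA -EFinM mulVf ?mul1e ?gt_eqF.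
Qed.

Lemma integral_perturbed_le F : measurable_fun [set: T] F -> (forall t, 0 <= F t) ->
  \int[perturbed_posterior u q]_t F t <= (c ^+ 2)%:E * \int[q]_t F t.
Proof.
move=> mF F0; rewrite ge0_integral_perturbed// -ge0_integralZl//; last first.
  by rewrite lee_fin sqr_ge0.
apply: ge0_le_integral => //.
- by move=> t _; rewrite mule_ge0// lee_fin normalized_weight_ge0.
- apply: emeasurable_funM => //; apply/measurable_EFinP.
  exact: measurable_normalized_weight.
- exact: measurable_funeM.
- move=> t _; apply: lee_wpmul2r => //; rewrite lee_fin expr2.
  have /andP[ut1 ut2] := uc t; have /andP[h1 h2] := hat_weight_bounds.
  apply: ler_pM => //.
  + exact/ltW/weight_gt0.
  + by rewrite invr_ge0 ltW.
  + exact: ltW.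
  + by rewrite -[leRHS]invrK lef_pV2// posrE invr_gt0.
Qed.

Variables (p : nat) (phi : T -> p.-tuple R).
Hypothesis mphi : measurable_fun [set: T] phi.

Let pi : probability T R := as_probability perturbed_posterior1.

Lemma sqdist_perturbed_mean_le (b : p.-tuple R) :
  (sqdist b (mean (perturbed_posterior u q) phi))%:E <=
  (c ^+ 2)%:E * \int[q]_t (sqdist b (phi t))%:E.
Proof.
apply: le_trans (integral_perturbed_le _ _).
- exact: (sqdist_mean_le pi mphi).
- by apply/measurable_EFinP; exact: measurable_sqdist.
- by move=> t; rewrite lee_fin sqdist_ge0.
Qed.

(** [sqdist_loss_perturbation] for the perturbed posterior, multiplied by
    [hat_weight u q] so that the normalization disappears from both losses.  In
    the last term one factor [c] bounds [hat_weight u q], and each of the two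
    changes from the perturbed posterior to [q] costs [c ^+ 2]. *)
Lemma perturbed_loss_le (v : T -> R) (a b : p.-tuple R) :
  measurable_fun [set: T] v -> (forall x, (0 <= v x <= 1)%R) ->
  \int[q]_x (sqdist (phi x) b)%:E < +oo ->
  \int[q]_x ((u x)%:E *
    (sqdist (phi x) (mean (perturbed_posterior u q) phi) * v x ^+ 2)%:E) <=
  \int[q]_x ((u x)%:E * (sqdist (phi x) a * v x ^+ 2)%:E) +
  (c ^+ 5)%:E *
    \int[q]_y \int[q]_x (sqdist (phi x) (phi y) * (v x - v y) ^+ 2)%:E.
Proof.
move=> mv v01 phioo.
have msq (e : p.-tuple R) (w : T -> R) : measurable_fun [set: T] w ->
    measurable_fun [set: T] (fun x => (sqdist (phi x) e * w x ^+ 2)%:E).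
  move=> mw; apply/measurable_EFinP; apply: measurable_funM.
    exact: measurable_sqdist.
  exact: measurable_funX.
have sq0 e (w : T -> R) x : 0 <= (sqdist (phi x) e * w x ^+ 2)%:E.
  by rewrite lee_fin mulr_ge0 ?sqdist_ge0 ?sqr_ge0.
rewrite -!hat_weight_integral_perturbed//; [|exact: msq|exact: msq].
have hat0 : 0 <= (hat_weight u q)%:E by rewrite lee_fin ltW.
have main := @sqdist_loss_perturbation _ _ _ pi p phi mphi v a b mv v01.
have pioo : \int[pi]_x (sqdist (phi x) b)%:E < +oo.
  apply: le_lt_trans (integral_perturbed_le _ _) _.
  - by apply/measurable_EFinP; exact: measurable_sqdist.
  - by move=> t; rewrite lee_fin sqdist_ge0.
  - by rewrite lte_mul_pinfty ?lee_fin ?sqr_ge0.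
have {main}main := lee_wpmul2l hat0 (main pioo).
apply: le_trans main _.
pose qp : probability T R := as_probability q1.
pose G (z : T * T) := (sqdist (phi z.2) (phi z.1) * (v z.2 - v z.1) ^+ 2)%:E.
have mG : measurable_fun [set: T * T] G.
  apply/measurable_EFinP; apply: measurable_funM.
    apply: measurable_sqdist.
      exact: measurableT_comp mphi measurable_snd.
    exact: measurableT_comp mphi measurable_fst.
  apply: measurable_funX; apply: measurable_funB.
    exact: measurableT_comp mv measurable_snd.
  exact: measurableT_comp mv measurable_fst.
have G0 z : 0 <= G z by rewrite lee_fin mulr_ge0 ?sqdist_ge0 ?sqr_ge0.
have mGy y : measurable_fun [set: T] (fun x => G (y, x)).
  by apply: (measurableT_comp mG); exact: pair1_measurable.
have mGF (m : probability T R) : measurable_fun [set: T] (fun y => \int[m]_x G (y, x)).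
  exact: (@measurable_fun_fubini_tonelli_F _ _ _ _ _ m G).
rewrite ge0_muleDr; last 2 first.
- by apply: integral_ge0 => x _; exact: sq0.
- by apply: integral_ge0 => y _; apply: integral_ge0 => x _; exact: (G0 (y, x)).
apply: leeD => //.
apply: (@le_trans _ _ (c%:E * ((c ^+ 2)%:E *
    ((c ^+ 2)%:E * \int[q]_y \int[q]_x G (y, x))))); last first.
  by rewrite (_ : c ^+ 5 = c * (c ^+ 2 * c ^+ 2))%R ?EFinM ?muleA//; ring.
apply: lee_pmul => //.
- by apply: integral_ge0 => y _; apply: integral_ge0 => x _; exact: (G0 (y, x)).
- by rewrite lee_fin; have /andP[] := hat_weight_bounds.
apply: le_trans (integral_perturbed_le (F := fun y => \int[pi]_x G (y, x)) _ _) _.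
- exact: (mGF pi).
- by move=> y; apply: integral_ge0 => x _; exact: (G0 (y, x)).
apply: lee_wpmul2l; first by rewrite lee_fin sqr_ge0.
rewrite -ge0_integralZl//; last 3 first.
- exact: (mGF qp).
- by move=> y _; apply: integral_ge0 => x _; exact: (G0 (y, x)).
- by rewrite lee_fin sqr_ge0.
apply: ge0_le_integral => //.
- by move=> y _; apply: integral_ge0 => x _; exact: (G0 (y, x)).
- by apply: measurable_funeM; exact: (mGF qp).
- by move=> y _; apply: integral_perturbed_le.
Qed.

End fixed.
End perturbed_posterior.

(** * Reversibility of the chain weighted by a symmetric function *)

Section kernel_fst.
Context d d' d2 (X : measurableType d) (Y : measurableType d')
  (Z : measurableType d2) (R : realType) (k : R.-pker X ~> Z).

(** This is [k] with a dummy second argument; it gives the joint measurability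
    of integrals against [Q x] whose integrand depends on a further variable. *)
Definition kernel_fst (z : X * Y) : {measure set Z -> \bar R} := k z.1.

Let measurable_kernel_fst U : measurable U ->
  measurable_fun [set: X * Y] (kernel_fst ^~ U).
Proof.
by move=> mU; apply: (measurableT_comp (measurable_kernel k U mU)); exact: measurable_fst.
Qed.

HB.instance Definition _ := isKernel.Build _ _ _ _ _ kernel_fst measurable_kernel_fst.

Let prob_kernel_fst z : kernel_fst z [set: Z] = 1.
Proof. exact: prob_kernel. Qed.

HB.instance Definition _ :=
  Kernel_isProbability.Build _ _ _ _ _ kernel_fst prob_kernel_fst.

End kernel_fst.

Section eaton.
Context d d' (X : measurableType d) (Theta : measurableType d') (R : realType).
Variables (P : R.-pker Theta ~> X) (Q : R.-pker X ~> Theta).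
Variable nu : {measure set Theta -> \bar R}.
Hypothesis posteriorQ : formal_posterior P nu Q.

(** The joint law of the present and the next state is a mixture, over the
    marginal, of squares of the posterior: this is where the symmetry of the
    expected posterior comes from. *)
Lemma integral_eaton_disintegration (F : Theta * Theta -> \bar R) :
  measurable_fun [set: Theta * Theta] F -> (forall z, 0 <= F z) ->
  \int[nu]_eta \int[eaton_kernel P Q eta]_t F (eta, t) =
  \int[marginal P nu]_x \int[Q x]_eta \int[Q x]_t F (eta, t).
Proof.
move=> mF F0.
pose H (z : X * Theta) := \int[Q z.1]_t F (z.2, t).
have mH : measurable_fun [set: X * Theta] H.
  apply: (@measurable_fun_integral_sfinite_kernel _ _ _ _ _
    (fun w : (X * Theta) * Theta => F (w.1.2, w.2)) (kernel_fst (Y := Theta) Q)) => //.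
  apply: (measurableT_comp mF); apply/measurable_fun_pairP; split.
    exact: measurableT_comp measurable_snd measurable_fst.
  exact: measurable_snd.
have H0 z : 0 <= H z by exact: integral_ge0.
rewrite (ge0_integral_disintegration posteriorQ mH H0).
apply: eq_integral => eta _; rewrite ge0_integral_eaton//.
by apply: (measurableT_comp mF); exact: pair1_measurable.
Qed.

Lemma eaton_reversible (F : Theta * Theta -> \bar R) :
  measurable_fun [set: Theta * Theta] F -> (forall z, 0 <= F z) ->
  \int[nu]_eta \int[eaton_kernel P Q eta]_t F (eta, t) =
  \int[nu]_eta \int[eaton_kernel P Q eta]_t F (t, eta).
Proof.
move=> mF F0.
rewrite (integral_eaton_disintegration (F := fun z => F (z.2, z.1)))//; last first.
  by apply: (measurableT_comp mF); exact: measurable_swap.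
rewrite (integral_eaton_disintegration mF F0).
apply: eq_integral => x _.
pose q : probability Theta R := as_probability (@prob_kernel _ _ _ _ _ Q x).
exact: (@fubini_tonelli _ _ _ _ _ q q).
Qed.

Variable f : Theta -> Theta -> R.
Hypotheses (f_ge0 : forall t eta, (0 <= f t eta)%R)
  (mf : measurable_fun [set: Theta * Theta] (fun z => f z.1 z.2))
  (fC : forall t eta, f t eta = f eta t)
  (Tpos : forall eta, 0 < total_weight f (eaton_kernel P Q) eta < +oo).

Local Notation T := (total_weight f (eaton_kernel P Q)).

Let mfE : measurable_fun [set: Theta * Theta] (fun z => (f z.2 z.1)%:E).
Proof.
apply/measurable_EFinP.
exact: (measurableT_comp mf (@measurable_swap _ _ Theta Theta)).
Qed.

Lemma measurable_total_weight : measurable_fun [set: Theta] T.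
Proof.
apply: (@measurable_fun_integral_sfinite_kernel _ _ _ _ _
  (fun z : Theta * Theta => (f z.2 z.1)%:E) (mkcomp_noparam P Q)) => //.
by move=> z; rewrite lee_fin.
Qed.

Lemma fine_total_weight_gt0 eta : (0 < fine (T eta))%R.
Proof. by apply: fine_gt0; exact: Tpos. Qed.

Lemma fine_total_weightK eta : (fine (T eta))%:E = T eta.
Proof. by rewrite fineK// gt0_fin_numE; have /andP[] := Tpos eta. Qed.

Let m_step eta : measurable_fun [set: Theta] (fun t => f t eta / fine (T eta))%R.
Proof.
by apply: measurable_funM => //; exact: (measurableT_comp mf (pair2_measurable eta)).
Qed.

Let step_ge0 eta t : (0 <= f t eta / fine (T eta))%R.
Proof. by rewrite divr_ge0// ltW// fine_total_weight_gt0. Qed.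

(** [weighted_kernel] packaged as a measure in its second argument: the two have
    convertible values, so that a chain for one is a chain for the other. *)
Definition step_kernel (eta : Theta) : {measure set Theta -> \bar R} :=
  density (eaton_kernel P Q eta) (m_step eta) (step_ge0 eta).

Let m_fineT : measurable_fun [set: Theta] (fun eta => fine (T eta)).
Proof. by apply: measurableT_comp => //; exact: measurable_total_weight. Qed.

Let fineT_ge0 eta : (0 <= fine (T eta))%R.
Proof. exact/ltW/fine_total_weight_gt0. Qed.

Let mratio : measurable_fun [set: Theta * Theta]
  (fun z => (f z.2 z.1 / fine (T z.1))%:E).
Proof.
apply/measurable_EFinP; apply: measurable_funM; first exact/measurable_EFinP.
exact: measurableT_comp (measurable_inv_ge0 m_fineT fineT_ge0) measurable_fst.
Qed.

Lemma measurable_step_kernel U : measurable U ->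
  measurable_fun [set: Theta] (step_kernel ^~ U).
Proof.
move=> mU; rewrite /step_kernel /= /density.
under eq_fun do rewrite integral_mkcond.
apply: (@measurable_fun_integral_sfinite_kernel _ _ _ _ _
  (fun z : Theta * Theta => ((fun t => (f t z.1 / fine (T z.1))%:E) \_ U) z.2)
  (mkcomp_noparam P Q)).
  by move=> z; apply: erestrict_ge0 => t _; rewrite lee_fin.
rewrite (_ : (fun _ => _) = (fun z => (f z.2 z.1 / fine (T z.1))%:E * (\1_U z.2)%:E)).
  apply: emeasurable_funM => //; apply/measurable_EFinP.
  by apply: measurableT_comp; [exact: measurable_indic|exact: measurable_snd].
by apply/funext => z; rewrite patchE indicE; case: ifP; rewrite ?mule1 ?mule0.
Qed.

HB.instance Definition _ := isKernel.Build _ _ _ _ _ step_kernel measurable_step_kernel.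

Lemma ge0_integral_step eta (F : Theta -> \bar R) :
  measurable_fun [set: Theta] F -> (forall t, 0 <= F t) ->
  T eta * \int[step_kernel eta]_t F t =
  \int[eaton_kernel P Q eta]_t ((f t eta)%:E * F t).
Proof.
move=> mF F0; rewrite ge0_integral_density// -fine_total_weightK -ge0_integralZl//.
- apply: eq_integral => t _; rewrite muleA -EFinM mulrCA divff ?mulr1//.
  by rewrite gt_eqF// fine_total_weight_gt0.
- by apply: emeasurable_funM => //; exact/measurable_EFinP.
- by move=> t _; rewrite mule_ge0// lee_fin.
- by rewrite lee_fin ltW// fine_total_weight_gt0.
Qed.

Lemma step_kernel1 eta : step_kernel eta [set: Theta] = 1.
Proof.
have := ge0_integral_step eta (F := cst 1) (measurable_cst _) (fun=> lee01).
rewrite integral_cst// mul1e.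
under eq_integral do rewrite mule1.
rewrite -[RHS]/(T eta) -{1}fine_total_weightK => h.
have /(congr1 (fun z => ((fine (T eta))^-1)%:E * z)) := h.
rewrite muleA -EFinM mulVf ?mul1e ?gt_eqF ?fine_total_weight_gt0// => ->.
by rewrite -fine_total_weightK -EFinM mulVf// gt_eqF ?fine_total_weight_gt0.
Qed.

HB.instance Definition _ :=
  Kernel_isProbability.Build _ _ _ _ _ step_kernel step_kernel1.

Definition step_reversing : {measure set Theta -> \bar R} :=
  density nu m_fineT fineT_ge0.

Lemma integral_step_reversing (F : Theta -> \bar R) :
  measurable_fun [set: Theta] F -> (forall t, 0 <= F t) ->
  \int[step_reversing]_t F t = \int[nu]_t (T t * F t).
Proof.
move=> mF F0; rewrite ge0_integral_density//.
by apply: eq_integral => t _; rewrite fine_total_weightK.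
Qed.

Lemma integral_step_reversing_pair (F : Theta * Theta -> \bar R) :
  measurable_fun [set: Theta * Theta] F -> (forall z, 0 <= F z) ->
  \int[step_reversing]_eta \int[step_kernel eta]_t F (eta, t) =
  \int[nu]_eta \int[eaton_kernel P Q eta]_t ((f t eta)%:E * F (eta, t)).
Proof.
move=> mF F0; rewrite integral_step_reversing.
- apply: eq_integral => eta _; rewrite ge0_integral_step//.
  by apply: (measurableT_comp mF); exact: pair1_measurable.
- exact: (@measurable_fun_integral_sfinite_kernel _ _ _ _ _ F step_kernel).
- by move=> eta; exact: integral_ge0.
Qed.

Lemma step_kernel_reversible : reversible step_reversing step_kernel.
Proof.
move=> F mF F0.
have mF' : measurable_fun [set: Theta * Theta] (fun z => F (z.2, z.1)).
  by apply: (measurableT_comp mF); exact: measurable_swap.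
apply: (etrans (integral_step_reversing_pair mF F0)).
apply: (etrans _ (esym (integral_step_reversing_pair mF' (fun z => F0 (z.2, z.1))))).
rewrite (eaton_reversible (F := fun z => (f z.2 z.1)%:E * F z)).
- by apply: eq_integral => eta _; apply: eq_integral => t _; rewrite fC.
- exact: emeasurable_funM.
- by move=> z; rewrite mule_ge0// lee_fin.
Qed.

End eaton.

(** * Risk functions and the inequality of Blyth type *)

Section admissibility.
Context d d' (X : measurableType d) (Theta : measurableType d') (R : realType).
Variables (P : R.-pker Theta ~> X) (Q : R.-pker X ~> Theta).
Variable nu : {measure set Theta -> \bar R}.
Hypothesis posteriorQ : formal_posterior P nu Q.
Variable f : Theta -> Theta -> R.
Hypotheses (f_ge0 : forall t eta, (0 <= f t eta)%R)
  (mf : measurable_fun [set: Theta * Theta] (fun z => f z.1 z.2))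
  (fC : forall t eta, f t eta = f eta t)
  (Tpos : forall eta, 0 < total_weight f (eaton_kernel P Q) eta < +oo).

Local Notation T := (total_weight f (eaton_kernel P Q)).

Let mfE : measurable_fun [set: Theta * Theta] (fun z => (f z.2 z.1)%:E).
Proof.
apply/measurable_EFinP.
exact: (measurableT_comp mf (@measurable_swap _ _ Theta Theta)).
Qed.

Let mfeta eta : measurable_fun [set: Theta] (fun t => (f t eta)%:E).
Proof. by apply/measurable_EFinP; exact: (measurableT_comp mf (pair2_measurable eta)). Qed.

Let Q1 x : Q x [set: Theta] = 1. Proof. exact: prob_kernel. Qed.

Let mQf : measurable_fun [set: X * Theta] (fun z => \int[Q z.1]_t (f t z.2)%:E).
Proof.
apply: (@measurable_fun_integral_sfinite_kernel _ _ _ _ _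
  (fun w : (X * Theta) * Theta => (f w.2 w.1.2)%:E) (kernel_fst (Y := Theta) Q)).
  by move=> z; rewrite lee_fin.
have h : measurable_fun [set: (X * Theta) * Theta] (fun w => (w.1.2, w.2)).
  apply/measurable_fun_pairP; split; last exact: measurable_snd.
  exact: measurableT_comp measurable_snd measurable_fst.
exact: (measurableT_comp mfE h).
Qed.

(** The integral over the joint law of [x] and [eta] of the indicator that
    [int f(., eta) dQ(. | x)] is infinite vanishes, since for each [eta] the
    integral of this quantity against [P eta] is [total_weight] at [eta].
    Disintegrating the other way, for almost every [x] this fails for almost
    every [eta], hence for at least one. *)
Lemma posterior_integral_lt_pinfty_ae :
  {ae marginal P nu, forall x, exists eta, \int[Q x]_t (f t eta)%:E < +oo}.
Proof.
pose S := [set z : X * Theta | \int[Q z.1]_t (f t z.2)%:E = +oo].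
have mS : measurable S.
  by rewrite -[S]setTI; exact: (mQf measurableT (emeasurable_set1 +oo)).
have m1S : measurable_fun [set: X * Theta] (EFin \o \1_S : X * Theta -> \bar R).
  exact/measurable_EFinP/measurable_indic.
have S0 (z : X * Theta) : 0 <= (EFin \o \1_S) z :> \bar R by rewrite lee_fin.
have int0 : \int[marginal P nu]_x \int[Q x]_eta (EFin \o \1_S) (x, eta) = 0.
  rewrite (ge0_integral_disintegration posteriorQ m1S S0).
  apply: integral0_eq => eta _.
  have mQfeta : measurable_fun [set: X] (fun x => \int[Q x]_t (f t eta)%:E).
    exact: (measurableT_comp mQf (pair2_measurable eta)).
  have Qf0 x : 0 <= \int[Q x]_t (f t eta)%:E.
    by apply: integral_ge0 => t _; rewrite lee_fin.
  have fin : (P eta).-integrable [set: X] (fun x => \int[Q x]_t (f t eta)%:E).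
    apply/integrableP; split=> //.
    under eq_integral do rewrite gee0_abs//.
    rewrite -ge0_integral_eaton//; last by move=> t; rewrite lee_fin.
    by have /andP[] := Tpos eta.
  rewrite (@ge0_ae_eq_integral _ _ _ _ _ _ (cst 0))//.
  - by rewrite integral0.
  - exact: (measurableT_comp m1S (pair2_measurable eta)).
  - apply: filterS (integrable_ae measurableT fin) => x /(_ Logic.I) finx _ /=.
    by rewrite indicE memNset// /S /= => fx; rewrite fx in finx.
have mg : measurable_fun [set: X] (fun x => \int[Q x]_eta (EFin \o \1_S) (x, eta)).
  exact: (measurable_integral_pker Q m1S S0).
have g0 x : 0 <= \int[Q x]_eta (EFin \o \1_S) (x, eta).
  by apply: integral_ge0 => eta _; exact: (S0 (x, eta)).
have : ae_eq (marginal P nu) setT (fun x => \int[Q x]_eta (EFin \o \1_S) (x, eta)) (cst 0).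
  apply/ae_eq_integral_abs => //.
  by under eq_integral do rewrite gee0_abs//.
apply: filterS => x /(_ Logic.I) /= gx0.
apply: contrapT => nex.
have : \int[Q x]_eta (\1_S (x, eta))%:E = \int[Q x]_eta (cst 1 eta).
  apply: eq_integral => eta _; rewrite indicE mem_set// /S /=.
  apply/eqP; rewrite -leye_eq leNgt; apply/negP => lt.
  by apply: nex; exists eta.
rewrite gx0 integral_cst// mul1e Q1 => /esym/eqP.
by rewrite onee_eq0.
Qed.

Variables (p : nat) (phi : Theta -> p.-tuple R) (Mphi : R).
Hypotheses (mphi : measurable_fun [set: Theta] phi)
  (phif : forall t eta, (sqdist (phi t) (phi eta) <= Mphi * f t eta)%R)
  (Mphi_gt0 : (0 < Mphi)%R).

Let msq : measurable_fun [set: Theta * Theta] (fun z => sqdist (phi z.2) (phi z.1)).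
Proof.
apply: measurable_sqdist.
  exact: measurableT_comp mphi measurable_snd.
exact: measurableT_comp mphi measurable_fst.
Qed.

Let msqt (b : p.-tuple R) : measurable_fun [set: Theta] (fun t => sqdist (phi t) b).
Proof. exact: measurable_sqdist. Qed.

Section risk.
Variable delta : X -> p.-tuple R.
Hypothesis mdelta : measurable_fun [set: X] delta.

Lemma risk_ge0 t : 0 <= risk P phi delta t.
Proof. by apply: integral_ge0 => x _; rewrite lee_fin sqdist_ge0. Qed.

Lemma measurable_risk : measurable_fun [set: Theta] (risk P phi delta).
Proof.
apply: (@measurable_fun_integral_sfinite_kernel _ _ _ _ _
  (fun z : Theta * X => (sqdist (phi z.1) (delta z.2))%:E) P).
  by move=> z; rewrite lee_fin sqdist_ge0.
apply/measurable_EFinP; apply: measurable_sqdist.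
  exact: measurableT_comp mphi measurable_fst.
exact: measurableT_comp mdelta measurable_snd.
Qed.

Lemma integral_weighted_risk (w : Theta -> R) :
  measurable_fun [set: Theta] w -> (forall t, (0 <= w t)%R) ->
  \int[nu]_t ((w t)%:E * risk P phi delta t) =
  \int[marginal P nu]_x \int[Q x]_t ((w t)%:E * (sqdist (phi t) (delta x))%:E).
Proof.
move=> mw w0.
pose F (z : X * Theta) := (w z.2)%:E * (sqdist (phi z.2) (delta z.1))%:E.
have mF : measurable_fun [set: X * Theta] F.
  apply: emeasurable_funM; apply/measurable_EFinP.
    exact: measurableT_comp mw measurable_snd.
  apply: measurable_sqdist.
    exact: measurableT_comp mphi measurable_snd.
  exact: measurableT_comp mdelta measurable_fst.
have F0 z : 0 <= F z by rewrite mule_ge0// lee_fin// sqdist_ge0.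
rewrite (ge0_integral_disintegration posteriorQ mF F0).
apply: eq_integral => t _; rewrite /F /= ge0_integralZl//.
- by apply/measurable_EFinP; exact: measurable_sqdist.
- by move=> x _; rewrite lee_fin sqdist_ge0.
- by rewrite lee_fin.
Qed.

End risk.

Variable u : bounded_weight Theta R.
Variable c : R.
Hypotheses (c1 : (1 < c)%R) (uc : forall t, (c^-1 < u t < c)%R).

Let delta := bayes_estimator (fun x => perturbed_posterior u (Q x)) phi.

Lemma measurable_bayes_estimator : measurable_fun [set: X] delta.
Proof.
apply/measurable_fun_tnthP => i.
have mphii : measurable_fun [set: Theta] (fun t => (tnth (phi t) i)%:E).
  by apply/measurable_EFinP; move/measurable_fun_tnthP : mphi; exact.
have mint (F : Theta -> \bar R) : measurable_fun [set: Theta] F -> (forall t, 0 <= F t) ->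
    measurable_fun [set: X] (fun x => \int[perturbed_posterior u (Q x)]_t F t).
  move=> mF F0.
  under eq_fun do rewrite (ge0_integral_perturbed u _ mF F0).
  apply: (@measurable_fun_integral_sfinite_kernel _ _ _ _ _
    (fun z : X * Theta => (u z.2 / hat_weight u (Q z.1))%:E * F z.2) Q).
    by move=> z; rewrite mule_ge0// lee_fin normalized_weight_ge0.
  apply: emeasurable_funM; last exact: measurableT_comp mF measurable_snd.
  apply/measurable_EFinP; apply: measurable_funM.
    exact: measurableT_comp (measurable_weight u) measurable_snd.
  have mhat : measurable_fun [set: X] (fun x => hat_weight u (Q x)).
    apply: measurableT_comp => //; apply: measurable_fun_integral_kernel.
    - by move=> U mU; exact: measurable_kernel.
    - by move=> t; rewrite lee_fin weight_ge0.
    - exact/measurable_EFinP/measurable_weight.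
  have hat0 x : (0 <= hat_weight u (Q x))%R.
    by apply: Rintegral_ge0 => t _; exact: weight_ge0.
  exact: measurableT_comp (measurable_inv_ge0 mhat hat0) measurable_fst.
rewrite (_ : _ \o _ = fun x => fine (\int[perturbed_posterior u (Q x)]_t (tnth (phi t) i)%:E)).
  apply: measurableT_comp => //.
  under eq_fun do rewrite integralE.
  apply: emeasurable_funB; apply: mint => //.
  - exact: measurable_funepos.
  - exact: measurable_funeneg.
by apply/funext => x /=; rewrite /delta /bayes_estimator tnth_mktuple.
Qed.

(** By Jensen's inequality the loss at [t] is at most [c ^+ 2] times the mean,
    under [Q x], of the squared distance from [phi t], and the symmetry of [f] turns its
    [P t]-integral into [total_weight] at [t]. *)
Lemma risk_bayes_estimator_le t :
  risk P phi delta t <= (c ^+ 2 * Mphi)%:E * T t.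
Proof.
rewrite /total_weight ge0_integral_eaton//; last by move=> ?; rewrite lee_fin.
have mI : measurable_fun [set: X] (fun x => \int[Q x]_s (f s t)%:E).
  apply: measurable_fun_integral_kernel => //.
  - by move=> U mU; exact: measurable_kernel.
  - by move=> s; rewrite lee_fin.
have cM0 : (0 <= c ^+ 2 * Mphi)%R by rewrite mulr_ge0 ?sqr_ge0// ltW.
rewrite -ge0_integralZl//; last first.
  by move=> x _; apply: integral_ge0 => s _; rewrite lee_fin.
apply: ge0_le_integral => //.
- by move=> x _; rewrite lee_fin sqdist_ge0.
- apply/measurable_EFinP; apply: measurable_sqdist => //.
  exact: measurable_bayes_estimator.
- exact: measurable_funeM.
- move=> x _; apply: le_trans (sqdist_perturbed_mean_le c1 uc (Q1 x) mphi _) _.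
  rewrite (EFinM (c ^+ 2) Mphi) -muleA; apply: lee_wpmul2l; first by rewrite lee_fin sqr_ge0.
  rewrite -ge0_integralZl//; [|by move=> s _; rewrite lee_fin|by rewrite lee_fin ltW].
  apply: ge0_le_integral => //.
  + by move=> s _; rewrite lee_fin sqdist_ge0.
  + by apply/measurable_EFinP; exact: measurable_sqdist.
  + exact: measurable_funeM.
  + by move=> s _; rewrite -EFinM lee_fin fC.
Qed.

Local Notation mu := (step_reversing nu f_ge0 mf Tpos).
Local Notation Tk := (step_kernel f_ge0 mf Tpos).
Local Notation lam := (perturbed_prior u nu).

Lemma ge0_integral_perturbed_prior F :
  measurable_fun [set: Theta] F -> (forall t, 0 <= F t) ->
  \int[lam]_t F t = \int[nu]_t ((u t)%:E * F t).
Proof. by move=> mF F0; rewrite ge0_integral_density. Qed.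

(** Integral over the marginal of [perturbed_loss_le] at [a = delta1 x]. *)
Lemma blyth_inequality (delta1 : X -> p.-tuple R) (v : Theta -> R) :
  measurable_fun [set: X] delta1 ->
  measurable_fun [set: Theta] v -> (forall t, (0 <= v t <= 1)%R) ->
  \int[lam]_t ((v t ^+ 2)%:E * risk P phi delta t) <=
  \int[lam]_t ((v t ^+ 2)%:E * risk P phi delta1 t) +
  (c ^+ 5 * Mphi)%:E * energy mu Tk v.
Proof.
move=> mdelta1 mv v01.
have mdelta := measurable_bayes_estimator.
have mv2 : measurable_fun [set: Theta] (fun t => v t ^+ 2)%R by exact: measurable_funX.
have muv2 : measurable_fun [set: Theta] (fun t => u t * v t ^+ 2)%R.
  by apply: measurable_funM => //; exact: measurable_weight.
have uv0 t : (0 <= u t * v t ^+ 2)%R by rewrite mulr_ge0 ?sqr_ge0 ?weight_ge0.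
have lamE (e : X -> p.-tuple R) : measurable_fun [set: X] e ->
    \int[lam]_t ((v t ^+ 2)%:E * risk P phi e t) =
    \int[marginal P nu]_x \int[Q x]_t ((u t)%:E * (sqdist (phi t) (e x) * v t ^+ 2)%:E).
  move=> me; rewrite ge0_integral_perturbed_prior; last 2 first.
  - by apply: emeasurable_funM; [exact/measurable_EFinP|exact: measurable_risk].
  - by move=> t; rewrite mule_ge0 ?risk_ge0// lee_fin sqr_ge0.
  under eq_integral do rewrite muleA -EFinM.
  rewrite (integral_weighted_risk me muv2 uv0).
  apply: eq_integral => x _; apply: eq_integral => t _.
  by rewrite -!EFinM; congr (_%:E); ring.
rewrite (lamE _ mdelta) (lamE _ mdelta1).
have mI (e : X -> p.-tuple R) : measurable_fun [set: X] e ->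
    measurable_fun [set: X]
      (fun x => \int[Q x]_t ((u t)%:E * (sqdist (phi t) (e x) * v t ^+ 2)%:E)).
  move=> me.
  apply: (@measurable_fun_integral_sfinite_kernel _ _ _ _ _
    (fun z : X * Theta => (u z.2)%:E * (sqdist (phi z.2) (e z.1) * v z.2 ^+ 2)%:E) Q).
    by move=> z; rewrite mule_ge0// lee_fin ?weight_ge0// mulr_ge0 ?sqdist_ge0 ?sqr_ge0.
  apply: emeasurable_funM; apply/measurable_EFinP.
    exact: measurableT_comp (measurable_weight u) measurable_snd.
  apply: measurable_funM; last exact: measurableT_comp mv2 measurable_snd.
  apply: measurable_sqdist.
    exact: measurableT_comp mphi measurable_snd.
  exact: measurableT_comp me measurable_fst.
have I0 (e : X -> p.-tuple R) x :
    0 <= \int[Q x]_t ((u t)%:E * (sqdist (phi t) (e x) * v t ^+ 2)%:E).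
  apply: integral_ge0 => t _.
  by rewrite mule_ge0// lee_fin ?weight_ge0// mulr_ge0 ?sqdist_ge0 ?sqr_ge0.
pose G (z : Theta * Theta) := (sqdist (phi z.2) (phi z.1) * (v z.2 - v z.1) ^+ 2)%:E.
have mdv : measurable_fun [set: Theta * Theta] (fun z => (v z.2 - v z.1) ^+ 2)%R.
  apply: measurable_funX; apply: measurable_funB.
    exact: measurableT_comp mv measurable_snd.
  exact: measurableT_comp mv measurable_fst.
have mG : measurable_fun [set: Theta * Theta] G.
  by apply/measurable_EFinP; exact: measurable_funM.
have G0 z : 0 <= G z by rewrite lee_fin mulr_ge0 ?sqdist_ge0 ?sqr_ge0.
have mQG : measurable_fun [set: X * Theta] (fun z => \int[Q z.1]_t G (z.2, t)).
  apply: (@measurable_fun_integral_sfinite_kernel _ _ _ _ _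
    (fun w : (X * Theta) * Theta => G (w.1.2, w.2)) (kernel_fst (Y := Theta) Q)) => //.
  have h : measurable_fun [set: (X * Theta) * Theta] (fun w => (w.1.2, w.2)).
    apply/measurable_fun_pairP; split; last exact: measurable_snd.
    exact: measurableT_comp measurable_snd measurable_fst.
  exact: (measurableT_comp mG h).
have QG0 (z : X * Theta) : 0 <= \int[Q z.1]_t G (z.2, t) by exact: integral_ge0.
have mQQG := measurable_integral_pker Q mQG QG0.
have QQG0 x : 0 <= \int[Q x]_eta \int[Q x]_t G (eta, t).
  by apply: integral_ge0 => eta _; exact: (QG0 (x, eta)).
have c50 : (0 <= c ^+ 5)%R by rewrite exprn_ge0// ltW// (lt_trans ltr01).
apply: (@le_trans _ _ (\int[marginal P nu]_x
  (\int[Q x]_t ((u t)%:E * (sqdist (phi t) (delta1 x) * v t ^+ 2)%:E) +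
   (c ^+ 5)%:E * \int[Q x]_eta \int[Q x]_t G (eta, t)))).
  apply: ae_ge0_le_integral => //.
  - exact: mI.
  - by move=> x _; rewrite adde_ge0// mule_ge0// lee_fin.
  - by apply: emeasurable_funD; [exact: mI|exact: measurable_funeM].
  - apply: filterS posterior_integral_lt_pinfty_ae => x [eta feta] _.
    apply: (@perturbed_loss_le _ _ _ _ _ c1 uc _ (Q1 x) _ _ mphi _ _ (phi eta) mv v01).
    apply: (@le_lt_trans _ _ (\int[Q x]_t (Mphi%:E * (f t eta)%:E))).
      apply: ge0_le_integral => //.
      - by move=> t _; rewrite lee_fin sqdist_ge0.
      - exact/measurable_EFinP.
      - exact: measurable_funeM.
      - by move=> t _; rewrite -EFinM lee_fin.
    rewrite ge0_integralZl//; last 2 first.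
    - by move=> t _; rewrite lee_fin.
    - by rewrite lee_fin ltW.
    by rewrite lte_mul_pinfty// lee_fin ltW.
rewrite (ge0_integralD _ measurableT); last 4 first.
- by move=> x _; exact: I0.
- exact: mI.
- by move=> x _; rewrite mule_ge0// lee_fin.
- exact: measurable_funeM.
apply: leeD => //.
rewrite ge0_integralZl//.
rewrite -(integral_eaton_disintegration posteriorQ mG G0).
rewrite (EFinM (c ^+ 5) Mphi) -muleA; apply: lee_wpmul2l; first by rewrite lee_fin.
pose D2 (z : Theta * Theta) := ((v z.2 - v z.1) ^+ 2)%:E.
have mD2 : measurable_fun [set: Theta * Theta] D2 by exact/measurable_EFinP.
have D20 z : 0 <= D2 z by rewrite lee_fin sqr_ge0.
rewrite /energy (integral_step_reversing_pair nu f_ge0 mf Tpos mD2 D20).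
have mfD : measurable_fun [set: Theta * Theta] (fun z => (f z.2 z.1)%:E * D2 z).
  exact: emeasurable_funM.
have fD0 z : 0 <= (f z.2 z.1)%:E * D2 z by rewrite mule_ge0// lee_fin.
have mRfD : measurable_fun [set: Theta] (fun eta =>
    \int[eaton_kernel P Q eta]_t ((f t eta)%:E * D2 (eta, t))).
  exact: (@measurable_fun_integral_sfinite_kernel _ _ _ _ _
    (fun z : Theta * Theta => (f z.2 z.1)%:E * D2 z) (mkcomp_noparam P Q)).
have RfD0 eta : 0 <= \int[eaton_kernel P Q eta]_t ((f t eta)%:E * D2 (eta, t)).
  by apply: integral_ge0 => t _; exact: (fD0 (eta, t)).
rewrite -ge0_integralZl//; last by rewrite lee_fin ltW.
apply: ge0_le_integral => //.
- by move=> eta _; apply: integral_ge0 => t _; exact: (G0 (eta, t)).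
- exact: (@measurable_fun_integral_sfinite_kernel _ _ _ _ _ G (mkcomp_noparam P Q)).
- exact: measurable_funeM.
- move=> eta _; rewrite -ge0_integralZl//.
  + apply: ge0_le_integral => //.
    * exact: (measurableT_comp mG (pair1_measurable eta)).
    * apply: measurable_funeM; exact: (measurableT_comp mfD (pair1_measurable eta)).
    * move=> t _; rewrite /G /D2 /= -!EFinM lee_fin mulrA.
      by rewrite ler_wpM2r// sqr_ge0.
  + exact: (measurableT_comp mfD (pair1_measurable eta)).
  + by move=> t _; exact: (fD0 (eta, t)).
  + by rewrite lee_fin ltW.
Qed.

(** [blyth_inequality] for [v = hit n]: both weighted risks are finite, so the
    integral of the risk difference over [D] is at most a constant times the
    energy of [hit n], which tends to 0. *)
Lemma risk_difference_null (D : set Theta) (delta1 : X -> p.-tuple R) :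
  measurable D -> \int[nu]_(t in D) T t < +oo ->
  {ae nu, forall t, D t -> (avoid Tk D n t)%:E @[n --> \oo] --> 0} ->
  measurable_fun [set: X] delta1 ->
  (forall t, risk P phi delta1 t <= risk P phi delta t) ->
  lam.-negligible (D `&` [set t | risk P phi delta1 t < risk P phi delta t]).
Proof.
move=> mD DT av0 mdelta1 dom.
have muD : mu D < +oo.
  rewrite (_ : mu D = \int[nu]_(t in D) T t)//.
  by apply: eq_integral => t _; rewrite (fine_total_weightK Tpos).
have av0mu : {ae mu, forall t, D t -> (avoid Tk D n t)%:E @[n --> \oo] --> 0}.
  case: av0 => A [mA nuA sA]; exists A; split=> //.
  exact: density_null.
have revT := step_kernel_reversible posteriorQ f_ge0 mf fC Tpos.
have cvE := energy_hit_cvg0 revT mD muD av0mu.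
have mrisk := measurable_risk measurable_bayes_estimator.
have mrisk1 := measurable_risk mdelta1.
have cM0 : (0 <= c ^+ 2 * Mphi)%R by rewrite mulr_ge0 ?sqr_ge0// ltW.
have risk_fin t : risk P phi delta t \is a fin_num.
  rewrite ge0_fin_numE ?risk_ge0// (le_lt_trans (risk_bayes_estimator_le t))//.
  have /andP[_ Ty] := Tpos t.
  by rewrite lte_mul_pinfty// lee_fin.
have risk1_fin t : risk P phi delta1 t \is a fin_num.
  rewrite ge0_fin_numE ?risk_ge0// (le_lt_trans (dom t))//.
  by rewrite -ge0_fin_numE ?risk_ge0.
pose r t := risk P phi delta t - risk P phi delta1 t.
have mr : measurable_fun [set: Theta] r by exact: emeasurable_funB.
have r0 t : 0 <= r t by rewrite /r sube_ge0 ?risk1_fin.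
have rE t : risk P phi delta t = risk P phi delta1 t + r t.
  by rewrite /r addeC subeK.
have main n : \int[lam]_(t in D) r t <= (c ^+ 5 * Mphi)%:E * energy mu Tk (hit Tk D n).
  pose v := hit Tk D n.
  have mv : measurable_fun [set: Theta] v := measurable_hit Tk mD n.
  have v01 t : (0 <= v t <= 1)%R := hit01 Tk mD n t.
  have v20 t : 0 <= (v t ^+ 2)%:E by rewrite lee_fin sqr_ge0.
  have mv2 : measurable_fun [set: Theta] (fun t => (v t ^+ 2)%:E).
    by apply/measurable_EFinP; exact: measurable_funX.
  have mvr (F : Theta -> \bar R) : measurable_fun [set: Theta] F ->
      measurable_fun [set: Theta] (fun t => (v t ^+ 2)%:E * F t).
    by move=> mF; exact: emeasurable_funM.
  have risk1_oo : \int[lam]_t ((v t ^+ 2)%:E * risk P phi delta1 t) < +oo.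
    have mT := measurable_total_weight P Q f_ge0 mf.
    have T0 t : 0 <= T t by have /andP[/ltW] := Tpos t.
    have v_oo := integral_hit_lt_pinfty revT mD n muD.
    rewrite ge0_integral_perturbed_prior//; last 2 first.
    - exact: mvr.
    - by move=> t; rewrite mule_ge0 ?risk_ge0.
    have K0 : (0 <= c * (c ^+ 2 * Mphi))%R.
      have c0 : (0 < c)%R by exact: lt_trans c1.
      by rewrite !mulr_ge0 ?sqr_ge0// ltW.
    apply: (@le_lt_trans _ _ (\int[nu]_t ((c * (c ^+ 2 * Mphi))%:E * (T t * (v t)%:E)))).
      apply: ge0_le_integral => //.
      + by move=> t _; rewrite !mule_ge0 ?risk_ge0// lee_fin weight_ge0.
      + by apply: emeasurable_funM; [exact/measurable_EFinP/measurable_weight|exact: mvr].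
      + by apply: measurable_funeM; apply: emeasurable_funM => //; exact/measurable_EFinP.
      + move=> t _; have /andP[v0 v1] := v01 t.
        have ut : (u t)%:E <= c%:E by rewrite lee_fin; have /andP[_ /ltW] := uc t.
        rewrite (EFinM c (c ^+ 2 * Mphi)) -muleA.
        apply: lee_pmul => //; first by rewrite lee_fin weight_ge0.
          by rewrite mule_ge0 ?risk_ge0.
        rewrite muleA muleC.
        apply: lee_pmul => //; first exact: risk_ge0.
          exact: le_trans (dom t) (risk_bayes_estimator_le t).
        by rewrite lee_fin expr2 ler_piMr.
    rewrite ge0_integralZl//; last 2 first.
    - by apply: emeasurable_funM => //; exact/measurable_EFinP.
    - by move=> t _; have /andP[v0 _] := v01 t; rewrite mule_ge0// lee_fin.
    rewrite lte_mul_pinfty ?lee_fin//.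
    rewrite -(integral_step_reversing nu f_ge0 mf Tpos)//.
    + exact/measurable_EFinP.
    + by move=> t; have /andP[v0 _] := v01 t; rewrite lee_fin.
  have := blyth_inequality mdelta1 mv v01.
  have -> : \int[lam]_t ((v t ^+ 2)%:E * risk P phi delta t) =
      \int[lam]_t ((v t ^+ 2)%:E * risk P phi delta1 t) + \int[lam]_t ((v t ^+ 2)%:E * r t).
    rewrite -ge0_integralD//.
    - by apply: eq_integral => t _; rewrite rE ge0_muleDr ?risk_ge0.
    - by move=> t _; rewrite mule_ge0 ?risk_ge0.
    - exact: mvr.
    - by move=> t _; rewrite mule_ge0.
    - exact: mvr.
  rewrite leeD2lE; last first.
    rewrite ge0_fin_numE//; apply: integral_ge0 => t _.
    by rewrite mule_ge0 ?risk_ge0.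
  apply: le_trans; rewrite integral_mkcond; apply: ge0_le_integral => //.
  - by move=> t _; apply: erestrict_ge0 => s _.
  - by apply/(measurable_restrictT _ _).1 => //; exact: measurable_funTS.
  - exact: mvr.
  - move=> t _; rewrite patchE; case: ifPn => [/set_mem Dt|_]; last by rewrite mule_ge0.
    by rewrite /v hit_eq1// expr1n mul1e.
have intr0 : \int[lam]_(t in D) r t = 0.
  apply/eqP; rewrite eq_le integral_ge0 ?andbT//.
  have cv : (c ^+ 5 * Mphi)%:E * energy mu Tk (hit Tk D n) @[n --> \oo] --> 0.
    by rewrite -(mule0 (c ^+ 5 * Mphi)%:E); apply: cvgeZl.
  rewrite -(cvg_lim _ cv)//; apply: lime_ge; first by apply/cvg_ex; exists 0.
  by apply: nearW => n; exact: main.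
have : ae_eq lam D r (cst 0).
  apply/(ae_eq_integral_abs lam mD); first exact: measurable_funTS.
  by rewrite -intr0; apply: eq_integral => t _; rewrite gee0_abs.
apply: negligibleS => t [Dt lt] /(_ Dt) /= rt0.
by move: lt; rewrite /= rE rt0 adde0 ltxx.
Qed.

End admissibility.

(** * Strong admissibility *)

Theorem theorem3p4 (R : realType) (X Theta : ptopologicalType)
  (polishX : polish R X) (polishTheta : polish R Theta)
  (P : R.-pker borel Theta ~> borel X)
  (nu : {sigma_finite_measure set (borel Theta) -> \bar R})
  (nu_infinite : nu [set: Theta] = +oo)
  (M_sigma_finite : sigma_finite [set: borel X] (marginal P nu))
  (Q : R.-pker borel X ~> borel Theta)
  (posteriorQ : formal_posterior P nu Q)
  (f : borel Theta -> borel Theta -> R)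
  (f_ge0 : forall theta eta, (0 <= f theta eta)%R)
  (f_meas : measurable_fun [set: borel Theta * borel Theta]
              (fun z => f z.1 z.2))
  (hyp_i : forall (p : nat) (phi : borel Theta -> p.-tuple R), (0 < p)%N ->
     Phi f phi ->
     exists2 K : nat -> set (borel Theta), exhaustion nu K &
       forall i, \int[nu]_(theta in K i)
                   risk P phi (bayes_estimator Q phi) theta < +oo)
  (hyp_ii_pos : forall eta,
     0 < total_weight f (eaton_kernel P Q) eta < +oo)
  (hyp_ii_exh : exists2 K : nat -> set (borel Theta), exhaustion nu K &
     forall i, \int[nu]_(eta in K i)
                 total_weight f (eaton_kernel P Q) eta < +oo)
  (hyp_iii : exists2 e : R, (0 < e)%R &
     {ae nu, forall eta, e%:E <= total_weight f (eaton_kernel P Q) eta})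
  (hyp_iv : forall theta eta, f theta eta = f eta theta)
  (d : measure_display) (Omega : measurableType d)
  (Pr : borel Theta -> probability Omega R)
  (W : nat -> Omega -> borel Theta)
  (chainW : markov_chain (weighted_kernel f (eaton_kernel P Q)) Pr W)
  (hyp_v : locally_recurrent nu Pr W) :
  forall (u : bounded_weight (borel Theta) R)
         (p : nat) (phi : borel Theta -> p.-tuple R),
    (0 < p)%N -> Phi f phi ->
    almost_admissible P (perturbed_prior u nu) phi
      (bayes_estimator (fun x => perturbed_posterior u (Q x)) phi).
Proof.
move=> u p phi _ [mphi [M M0 phif]] delta1 mdelta1 dom.
have [c c1 uc] := weight_bounded u.
have [K [mK _ cupK nuK] KT] := hyp_ii_exh.
set delta := bayes_estimator _ _.
set N := [set theta | _ < _].
have mdelta : measurable_fun [set: borel X] delta.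
  exact: (measurable_bayes_estimator Q mphi u).
have mN : measurable N.
  rewrite -[N]setTI; apply: measurable_lte => //.
    exact: (measurable_risk P mphi mdelta1).
  exact: (measurable_risk P mphi mdelta).
apply: measure_negligible => //.
(* Each [K i] has finite positive mass for [nu] and finite mass for
   [total_weight nu], so that it can play the role of [D]. *)
have -> : N = \bigcup_i (K i `&` N) by rewrite -setI_bigcupl cupK setTI.
apply: negligible_bigcup => i.
apply: (risk_difference_null (f_ge0 := f_ge0) (mf := f_meas) (Tpos := hyp_ii_pos)
  posteriorQ hyp_iv mphi phif M0 c1 uc (mK i) (KT i)) => //.
have : locally_recurrent_set nu Pr W (K i) := hyp_v (K i) (conj (mK i) (nuK i)).
rewrite /locally_recurrent_set.
apply: filterS => w hit1 Kw.
exact: (cvg_avoid_recurrent (Tk := step_kernel f_ge0 f_meas hyp_ii_pos) chainW (mK i) (hit1 Kw)).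
Qed.
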